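(* Let $\alpha\in(0,1]$ and let $(X,\|\cdot\|)$ be a Banach space whose norm $\|\cdot\|$ is differentiable with modulus of smoothness of power type $1+\alpha$. Let $X^*$ be the dual space with dual norm $\|\cdot\|_*$ and dual unit sphere $S^*$. Let $C\subseteq X$ and let $D:C\to S^*$ be a mapping. The following are equivalent: (1) There exists a $C^{1,\alpha}$ convex body $V$ such that $C\subseteq\partial V$ and, for every $x\in C$, the hyperplane $H_x:=\{y\in X: D(x)(y)=D(x)(x)\}$ is tangent to $\partial V$ at $x$ and $V\subseteq H_x^-:=\{y\in X: D(x)(y)\le D(x)(x)\}$. (2) There exists $\delta>0$ such that $$D(y)(y-x)\ge\delta\|D(x)-D(y)\|_*^{1+\frac1\alpha}\quad\text{for all }x,y\in C.$$ Moreover, if $C$ is bounded, then $V$ can be taken to be bounded as well.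
   Context: The modulus of smoothness of $\|\cdot\|$ is $\rho(t)=\sup\{\tfrac{\|x+th\|+\|x-th\|}{2}-1:\|x\|=\|h\|=1\}$; it is of power type $1+\alpha$ if $\rho(t)\le Kt^{1+\alpha}$ for some $K>0$ and all $t>0$ (such spaces are superreflexive). A convex body is a closed convex set with nonempty interior (possibly unbounded). A function $F:X\to\mathbb{R}$ is of class $C^{1,\alpha}$ if it is Fréchet differentiable and $\|DF(x)-DF(y)\|_*\le K\|x-y\|^\alpha$ for some $K>0$. A convex body $V$ is of class $C^{1,\alpha}$ if there exist $M>0$ and a convex $F\in C^{1,\alpha}(X)$ with $\partial V=F^{-1}(1)$ and $M^{-1}\le\|DF(x)\|_*\le M$ for all $x\in\partial V$. *)

(* Defs.v *)
From Stdlib Require Import Reals Lra ClassicalEpsilon.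
Open Scope R_scope.

Record Banach := {
  carrier :> Type;
  vzero : carrier;
  vadd : carrier -> carrier -> carrier;
  vopp : carrier -> carrier;
  vscal : R -> carrier -> carrier;
  vnorm : carrier -> R;
  vadd_assoc : forall x y z, vadd x (vadd y z) = vadd (vadd x y) z;
  vadd_comm : forall x y, vadd x y = vadd y x;
  vadd_0 : forall x, vadd x vzero = x;
  vadd_opp : forall x, vadd x (vopp x) = vzero;
  vscal_1 : forall x, vscal 1 x = x;
  vscal_assoc : forall a b x, vscal a (vscal b x) = vscal (a * b) x;
  vscal_distr_l : forall a x y, vscal a (vadd x y) = vadd (vscal a x) (vscal a y);
  vscal_distr_r : forall a b x, vscal (a + b) x = vadd (vscal a x) (vscal b x);
  vnorm_eq0 : forall x, vnorm x = 0 -> x = vzero;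
  vnorm_scal : forall a x, vnorm (vscal a x) = Rabs a * vnorm x;
  vnorm_triangle : forall x y, vnorm (vadd x y) <= vnorm x + vnorm y;
  vcomplete : forall u : nat -> carrier,
    (forall eps, 0 < eps -> exists N, forall m n, (N <= m)%nat -> (N <= n)%nat ->
        vnorm (vadd (u m) (vopp (u n))) < eps) ->
    exists l, forall eps, 0 < eps -> exists N, forall n, (N <= n)%nat ->
        vnorm (vadd (u n) (vopp l)) < eps
}.

Arguments vzero {_}.
Arguments vadd {_} _ _.
Arguments vopp {_} _.
Arguments vscal {_} _ _.
Arguments vnorm {_} _.

Definition vsub {X : Banach} (x y : X) : X := vadd x (vopp y).

Section Defs.
Variable X : Banach.

(** real power t^a, with the convention 0^a = 0 (used only for a > 0) *)
Definition pw (t a : R) : R := if Rle_dec t 0 then 0 else Rpower t a.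

Definition is_linear (f : X -> R) : Prop :=
  (forall x y, f (vadd x y) = f x + f y) /\ (forall a x, f (vscal a x) = a * f x).

Definition bounded_linear (f : X -> R) : Prop :=
  is_linear f /\ exists M, forall x, Rabs (f x) <= M * vnorm x.

Definition dnorm (f : X -> R) : R :=
  epsilon (inhabits 0)
    (is_lub (fun r => exists x : X, vnorm x <= 1 /\ r = Rabs (f x))).

Definition fsub (f g : X -> R) : X -> R := fun z => f z - g z.

Definition frechet_deriv (F : X -> R) (x : X) (L : X -> R) : Prop :=
  bounded_linear L /\
  forall eps, 0 < eps -> exists d, 0 < d /\ forall h : X, vnorm h < d ->
    Rabs (F (vadd x h) - F x - L h) <= eps * vnorm h.

Definition norm_differentiable : Prop :=
  forall x : X, x <> vzero -> exists L, frechet_deriv (fun y => vnorm y) x L.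

(** modulus of smoothness of power type 1+alpha:
    rho(t) <= K t^(1+alpha) for all t > 0, rho(t) being the sup below *)
Definition smoothness_power_type (alpha : R) : Prop :=
  exists K, 0 < K /\ forall t, 0 < t -> forall x h : X, vnorm x = 1 -> vnorm h = 1 ->
    (vnorm (vadd x (vscal t h)) + vnorm (vsub x (vscal t h))) / 2 - 1
      <= K * Rpower t (1 + alpha).

Definition C1alpha_fun (alpha : R) (F : X -> R) (DF : X -> X -> R) : Prop :=
  (forall x, frechet_deriv F x (DF x)) /\
  exists K, 0 < K /\ forall x y,
    dnorm (fsub (DF x) (DF y)) <= K * pw (vnorm (vsub x y)) alpha.

Definition convex_fun (F : X -> R) : Prop :=
  forall x y t, 0 <= t <= 1 ->
    F (vadd (vscal t x) (vscal (1 - t) y)) <= t * F x + (1 - t) * F y.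

Definition convex_set (V : X -> Prop) : Prop :=
  forall x y t, V x -> V y -> 0 <= t <= 1 -> V (vadd (vscal t x) (vscal (1 - t) y)).

Definition closed_set (V : X -> Prop) : Prop :=
  forall (u : nat -> X) l, (forall n, V (u n)) ->
    (forall eps, 0 < eps -> exists N, forall n, (N <= n)%nat -> vnorm (vsub (u n) l) < eps) ->
    V l.

Definition interior_point (V : X -> Prop) (x : X) : Prop :=
  exists r, 0 < r /\ forall y, vnorm (vsub y x) < r -> V y.

Definition boundary (V : X -> Prop) (x : X) : Prop :=
  forall r, 0 < r ->
    (exists y, vnorm (vsub y x) < r /\ V y) /\ (exists y, vnorm (vsub y x) < r /\ ~ V y).

Definition bounded_set (S : X -> Prop) : Prop :=
  exists M, forall x, S x -> vnorm x <= M.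

(** convex body: closed convex set with nonempty interior (possibly unbounded) *)
Definition convex_body (V : X -> Prop) : Prop :=
  closed_set V /\ convex_set V /\ exists x, interior_point V x.

Definition C1alpha_body (alpha : R) (V : X -> Prop) : Prop :=
  convex_body V /\
  exists M F DF, 0 < M /\ convex_fun F /\ C1alpha_fun alpha F DF /\
    (forall x, boundary V x <-> F x = 1) /\
    (forall x, boundary V x -> / M <= dnorm (DF x) <= M).

(** the hyperplane {y | f y = f x} is tangent to the boundary of V at x:
    x is a boundary point and dist-like deviation |f y - f x| = o(||y - x||)
    for boundary points y -> x *)
Definition tangent_at (V : X -> Prop) (f : X -> R) (x : X) : Prop :=
  boundary V x /\
  forall eps, 0 < eps -> exists d, 0 < d /\ forall y, boundary V y ->
    vnorm (vsub y x) < d -> Rabs (f y - f x) <= eps * vnorm (vsub y x).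

Definition maps_to_dual_sphere (C : X -> Prop) (D : X -> X -> R) : Prop :=
  forall x, C x -> bounded_linear (D x) /\ dnorm (D x) = 1.

Definition cond1_body (alpha : R) (C : X -> Prop) (D : X -> X -> R) (V : X -> Prop) : Prop :=
  C1alpha_body alpha V /\
  (forall x, C x -> boundary V x) /\
  (forall x, C x -> tangent_at V (D x) x /\ (forall y, V y -> D x y <= D x x)).

Definition cond2 (alpha : R) (C : X -> Prop) (D : X -> X -> R) : Prop :=
  exists delta, 0 < delta /\ forall x y, C x -> C y ->
    D y (vsub y x) >= delta * pw (dnorm (fsub (D x) (D y))) (1 + / alpha).

End Defs.

Arguments pw : clear implicits.

(* Main.v *)
(* (1) => (2): a convex C^{1,alpha} function satisfies
   F(x) >= F(y) + DF(y)(x-y) + k |DF(x) - DF(y)|^{1+1/alpha}; on the boundary F = 1 this is (2) for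
   DF, and a support functional of the body at a boundary point is a multiple of the gradient.

   (2) => (1): put G_y(x) = 1 + D(y)(x-y) + M |x-y|^{1+alpha}, let F be the largest convex function
   below all G_y (y in C), and V = {F <= 1}.  By (2) and Young's inequality the tangents
   1 + D(z)(x-z) lie below every G_y, hence below F, so F is squeezed between the tangent and
   G_z at each z in C.  All other properties of F come from its maximality: any convex function
   manufactured from F that still lies below every G_y lies below F.  This gives the
   second-difference bound that makes F of class C^{1,alpha}, two-sided bounds on |DF| along
   F = 1, and coercivity when C is bounded.  For empty C one applies the construction to a
   singleton with a support functional of the norm. *)
From Stdlib Require Import Reals Lra List ClassicalEpsilon IndefiniteDescription.
Require Import Defs.
Import ListNotations.
Open Scope R_scope.

(** * Real powers *)

Lemma pw_nonpos (t a : R) : t <= 0 -> pw t a = 0.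
Proof. intros H. unfold pw. destruct (Rle_dec t 0); [easy | lra]. Qed.

Lemma pw_pos (t a : R) : 0 < t -> pw t a = Rpower t a.
Proof. intros H. unfold pw. destruct (Rle_dec t 0); [lra | easy]. Qed.

Lemma pw_gt0 (t a : R) : 0 < t -> 0 < pw t a.
Proof. intros H. rewrite pw_pos by easy. apply exp_pos. Qed.

Lemma pw_ge0 (t a : R) : 0 <= pw t a.
Proof.
  destruct (Rle_dec t 0).
  - rewrite pw_nonpos by easy. lra.
  - apply Rlt_le, pw_gt0. lra.
Qed.

Lemma pw_mult (s t a : R) : 0 <= s -> 0 <= t -> pw (s * t) a = pw s a * pw t a.
Proof.
  intros Hs Ht.
  destruct (Req_dec s 0) as [->|]; [rewrite Rmult_0_l, (pw_nonpos 0); lra|].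
  destruct (Req_dec t 0) as [->|]; [rewrite Rmult_0_r, (pw_nonpos 0); lra|].
  assert (0 < s * t) by (apply Rmult_lt_0_compat; lra).
  rewrite !pw_pos by lra. symmetry. apply Rpower_mult_distr; lra.
Qed.

Lemma pw_le (s t a : R) : 0 <= a -> s <= t -> pw s a <= pw t a.
Proof.
  intros Ha Hst.
  destruct (Rle_dec s 0) as [Hs|Hs]; [rewrite (pw_nonpos s) by easy; apply pw_ge0|].
  rewrite !pw_pos by lra. apply Rle_Rpower_l; lra.
Qed.

Lemma pw_S (t a : R) : pw t (1 + a) = pw t a * t.
Proof.
  destruct (Rle_dec t 0) as [Ht|Ht]; [rewrite !pw_nonpos by easy; lra|].
  rewrite !pw_pos, Rpower_plus, Rpower_1 by lra. lra.
Qed.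

Lemma pw_pw (t a b : R) : pw (pw t a) b = pw t (a * b).
Proof.
  destruct (Rle_dec t 0) as [Ht|Ht]; [rewrite !(pw_nonpos t), pw_nonpos; lra|].
  rewrite (pw_pos (pw t a)) by (apply pw_gt0; lra).
  rewrite !pw_pos by lra. apply Rpower_mult.
Qed.

Lemma pw_1 (t : R) : 0 <= t -> pw t 1 = t.
Proof.
  intros [Ht|<-]; [|apply pw_nonpos; lra].
  rewrite pw_pos, Rpower_1; lra.
Qed.

Lemma pw_base1 (a : R) : pw 1 a = 1.
Proof. rewrite pw_pos by lra. unfold Rpower. rewrite ln_1, Rmult_0_r. apply exp_0. Qed.

Lemma pw_inv_exponent (t a : R) : 0 < a -> 0 <= t -> pw (pw t (/ a)) a = t.
Proof. intros Ha Ht. rewrite pw_pw, Rinv_l, pw_1; lra. Qed.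

Lemma ln_le_sub1 (x : R) : 0 < x -> ln x <= x - 1.
Proof. intros Hx. pose proof (exp_ineq1_le (ln x)) as H. rewrite exp_ln in H; lra. Qed.

(** With [w = 1 + a (t - 1)] the numbers [t / w] and [1 / w], weighted by [a] and [1 - a], average
    to 1. Applying [ln s <= s - 1] to both gives [a ln t <= ln w]. *)
Lemma bernoulli_le (a t : R) : 0 < a <= 1 -> 0 <= t -> pw t a <= 1 + a * (t - 1).
Proof.
  intros Ha [Ht|<-]; [|rewrite pw_nonpos; lra].
  rewrite pw_pos by easy.
  set (w := 1 + a * (t - 1)).
  assert (Hw : 0 < w) by (unfold w; nra).
  rewrite <- (exp_ln w) by easy. unfold Rpower.
  assert (H : a * ln t <= ln w).
  { pose proof (ln_le_sub1 (t * / w)) as H1. pose proof (ln_le_sub1 (/ w)) as H2.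
    assert (0 < / w) by now apply Rinv_0_lt_compat.
    assert (0 < t * / w) by now apply Rmult_lt_0_compat.
    rewrite ln_mult in H1 by easy. rewrite ln_Rinv in * by easy.
    specialize (H1 ltac:(easy)). specialize (H2 ltac:(easy)).
    assert (a * (t * / w) + (1 - a) * / w = 1) by (unfold w in *; field; lra).
    assert (a * (ln t + - ln w) <= a * (t * / w - 1)) by (apply Rmult_le_compat_l; lra).
    assert ((1 - a) * (- ln w) <= (1 - a) * (/ w - 1)) by (apply Rmult_le_compat_l; lra).
    lra. }
  destruct H as [H|H]; [apply Rlt_le, exp_increasing, H | rewrite H; lra].
Qed.

(** Bernoulli's bound times [t] equals [1 + (1 + a)(t - 1) + a (t - 1)^2]. This expansion at 1
    replaces the power by a linear term and a square when second differences of [|x|^(1+a)] are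
    estimated. *)
Lemma pw_quadratic_bound (a t : R) : 0 < a <= 1 -> 0 <= t ->
  pw t (1 + a) <= 1 + (1 + a) * (t - 1) + (t - 1) * (t - 1).
Proof.
  intros Ha Ht. rewrite pw_S. pose proof (bernoulli_le a t Ha Ht).
  pose proof (Rle_0_sqr (t - 1)). unfold Rsqr in *.
  assert (pw t a * t <= (1 + a * (t - 1)) * t) by now apply Rmult_le_compat_r.
  assert (a * ((t - 1) * (t - 1)) <= 1 * ((t - 1) * (t - 1))) by (apply Rmult_le_compat_r; lra).
  lra.
Qed.

Lemma sqr_le_pw (a t : R) : 0 < a <= 1 -> 0 <= t <= 1 -> t * t <= pw t (1 + a).
Proof.
  intros Ha [[Ht|<-] Ht1]; [|rewrite pw_nonpos; lra].
  rewrite pw_S. apply Rmult_le_compat_r; [lra|].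
  rewrite pw_pos by easy. rewrite <- (Rpower_1 t) at 1 by easy. unfold Rpower.
  assert (ln t <= 0) by (pose proof (ln_le_sub1 t Ht); lra).
  assert (H1 : 1 * ln t <= a * ln t) by nra.
  destruct H1 as [H1|H1]; [apply Rlt_le, exp_increasing, H1 | rewrite H1; lra].
Qed.

(** [r + 1] is at most twice the larger of [r] and 1, and [2^(1+a) <= 4]. *)
Lemma pw_add1_le (a r : R) : 0 < a <= 1 -> 0 <= r -> pw (r + 1) (1 + a) <= 4 * (pw r (1 + a) + 1).
Proof.
  intros Ha Hr.
  assert (H2 : pw 2 (1 + a) <= 4).
  { rewrite pw_S. pose proof (bernoulli_le a 2 Ha ltac:(lra)). lra. }
  assert (Hmax : forall s, 0 <= s -> pw (2 * s) (1 + a) <= 4 * pw s (1 + a)).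
  { intros s Hs. rewrite pw_mult by lra. apply Rmult_le_compat_r; [apply pw_ge0 | easy]. }
  pose proof (pw_ge0 r (1 + a)).
  destruct (Rle_dec r 1).
  - pose proof (Hmax 1 Rle_0_1) as H1. rewrite pw_base1 in H1.
    pose proof (pw_le (r + 1) (2 * 1) (1 + a) ltac:(lra) ltac:(lra)). lra.
  - specialize (Hmax r Hr).
    pose proof (pw_le (r + 1) (2 * r) (1 + a) ltac:(lra) ltac:(lra)). lra.
Qed.

(** If [r <= delta d^(1/a)], the first term alone dominates [d r]. Otherwise [d <= (r / delta)^a],
    and the second one does with [M = delta^(-a)]. *)
Lemma young_pw (a delta : R) : 0 < a -> 0 < delta ->
  exists M, 0 < M /\ forall d r, 0 <= d -> 0 <= r ->
    d * r <= delta * pw d (1 + / a) + M * pw r (1 + a).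
Proof.
  intros Ha Hd. exists (pw (/ delta) a).
  assert (0 < / delta) by now apply Rinv_0_lt_compat.
  split; [now apply pw_gt0|]. intros d r Hd0 Hr.
  rewrite !pw_S, <- Rmult_assoc, <- (Rmult_assoc (pw (/ delta) a)), <- pw_mult by lra.
  assert (0 <= delta * pw d (/ a)) by (pose proof (pw_ge0 d (/ a)); nra).
  pose proof (pw_ge0 (/ delta * r) a).
  destruct (Rle_dec r (delta * pw d (/ a))) as [Hc|Hc].
  - nra.
  - assert (d <= pw (/ delta * r) a).
    { rewrite <- (pw_inv_exponent d a) by easy. apply pw_le; [lra|].
      apply Rmult_le_reg_l with delta; [easy|].
      rewrite <- Rmult_assoc, Rinv_r; lra. }
    nra.
Qed.

Lemma pw_superlinear (a M : R) : 0 < a -> 0 < M ->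
  exists b, 0 < b /\ forall r, 0 <= r -> 2 * r <= M * pw r (1 + a) + b.
Proof.
  intros Ha HM.
  assert (0 < 2 / M) by (apply Rdiv_lt_0_compat; lra).
  (* The threshold where [M r^a = 2]: beyond it the power wins, below it [2 r <= 2 rho]. *)
  set (rho := pw (2 / M) (/ a)).
  assert (Hrho : 0 < rho) by now apply pw_gt0.
  exists (2 * rho). split; [lra|]. intros r Hr.
  pose proof (pw_ge0 r (1 + a)).
  destruct (Rle_dec r rho); [nra|].
  rewrite pw_S.
  assert (2 / M <= pw r a).
  { rewrite <- (pw_inv_exponent (2 / M) a) by lra. apply pw_le; [lra|]. fold rho. lra. }
  assert (2 <= M * pw r a).
  { replace 2 with (M * (2 / M)) by (field; lra). now apply Rmult_le_compat_l; [lra|]. }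
  nra.
Qed.

(** Divide by [t] and let [t] tend to 0. The proof takes a single [t] with [t^a = e], where [e] is
    so small that [B e < x - y]; [B] may have any sign. *)
Lemma pw_le_infinitesimal (a x y B : R) : 0 < a ->
  (forall t, 0 < t -> t * x <= t * y + B * pw t (1 + a)) -> x <= y.
Proof.
  intros Ha H. apply Rnot_lt_le. intros Hlt.
  assert (Hr : 0 < (x - y) / 2 / (Rabs B + 1)).
  { pose proof (Rabs_pos B). repeat apply Rdiv_lt_0_compat; lra. }
  set (e := (x - y) / 2 / (Rabs B + 1)) in *.
  specialize (H (pw e (/ a)) (pw_gt0 _ _ Hr)).
  pose proof (pw_gt0 e (/ a) Hr) as Ht. rewrite pw_S, pw_inv_exponent in H by lra.
  assert (B * e < x - y).
  { pose proof (Rabs_pos B). pose proof (Rle_abs B).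
    assert ((Rabs B + 1) * e = (x - y) / 2) by (unfold e; field; lra). nra. }
  nra.
Qed.

(** * Vector identities *)

(** Syntax of vector expressions over a list of atoms. Proof by reflection turns a vector identity
    into identities between the real coefficients of each atom. *)
Inductive vexp :=
  | VAtom (n : nat) | VZero | VAdd (e f : vexp) | VOpp (e : vexp) | VScal (a : R) (e : vexp).

Fixpoint vden {X : Banach} (l : list X) (e : vexp) : X :=
  match e with
  | VAtom n => nth n l vzero
  | VZero => vzero
  | VAdd e f => vadd (vden l e) (vden l f)
  | VOpp e => vopp (vden l e)
  | VScal a e => vscal a (vden l e)
  end.

Fixpoint vcoef (e : vexp) (i : nat) : R :=
  match e with
  | VAtom n => if Nat.eqb n i then 1 else 0
  | VZero => 0
  | VAdd e f => vcoef e i + vcoef f i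
  | VOpp e => - vcoef e i
  | VScal a e => a * vcoef e i
  end.

Fixpoint vcomb {X : Banach} (c : nat -> R) (l : list X) : X :=
  match l with
  | [] => vzero
  | x :: l => vadd (vscal (c O) x) (vcomb (fun i => c (S i)) l)
  end.

(** A finite conjunction, so that computation leaves one real equation per atom. *)
Fixpoint coefs_agree (c d : nat -> R) (n : nat) : Prop :=
  match n with
  | O => True
  | S n => c O = d O /\ coefs_agree (fun i => c (S i)) (fun i => d (S i)) n
  end.

Lemma vadd_0l {X : Banach} (x : X) : vadd vzero x = x.
Proof. rewrite vadd_comm. apply vadd_0. Qed.

Lemma vadd_cancel {X : Banach} (x y : X) : vadd x y = x -> y = vzero.
Proof.
  intros H. transitivity (vadd (vopp x) (vadd x y)).
  - now rewrite vadd_assoc, (vadd_comm _ (vopp x)), vadd_opp, vadd_0l.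
  - rewrite H, vadd_comm. apply vadd_opp.
Qed.

Lemma vscal_0l {X : Banach} (x : X) : vscal 0 x = vzero.
Proof. apply (vadd_cancel (vscal 0 x)). rewrite <- vscal_distr_r. f_equal; lra. Qed.

Lemma vscal_0r {X : Banach} (a : R) : vscal a (@vzero X) = vzero.
Proof. apply (vadd_cancel (vscal a vzero)). now rewrite <- vscal_distr_l, vadd_0. Qed.

Lemma vopp_scal {X : Banach} (x : X) : vopp x = vscal (-1) x.
Proof.
  assert (H : vadd (vscal (-1) x) x = vzero).
  { rewrite <- (vscal_1 X x) at 2. rewrite <- vscal_distr_r.
    replace (-1 + 1) with 0 by lra. apply vscal_0l. }
  now rewrite <- (vadd_0l (vopp x)), <- H, <- vadd_assoc, vadd_opp, vadd_0.
Qed.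

Lemma vcomb_ext {X : Banach} (c d : nat -> R) (l : list X) :
  coefs_agree c d (length l) -> vcomb c l = vcomb d l.
Proof.
  revert c d. induction l as [|x l IH]; intros c d; [easy|].
  simpl. intros [-> H]. now rewrite (IH _ _ H).
Qed.

Lemma coefs_agree_all (c d : nat -> R) (n : nat) :
  (forall i, c i = d i) -> coefs_agree c d n.
Proof. revert c d. induction n; intros c d H; simpl; auto. Qed.

Lemma vcomb_0 {X : Banach} (l : list X) : vcomb (fun _ => 0) l = vzero.
Proof. induction l; simpl; [easy|]. now rewrite IHl, vscal_0l, vadd_0. Qed.

Lemma vcomb_scal {X : Banach} (a : R) (c : nat -> R) (l : list X) :
  vcomb (fun i => a * c i) l = vscal a (vcomb c l).
Proof.
  revert c. induction l as [|x l IH]; intros c; simpl; [now rewrite vscal_0r|].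
  now rewrite (IH (fun i => c (S i))), vscal_distr_l, vscal_assoc.
Qed.

Lemma vcomb_add {X : Banach} (c d : nat -> R) (l : list X) :
  vcomb (fun i => c i + d i) l = vadd (vcomb c l) (vcomb d l).
Proof.
  revert c d. induction l as [|x l IH]; intros c d; simpl; [now rewrite vadd_0|].
  rewrite (IH (fun i => c (S i)) (fun i => d (S i))), vscal_distr_r.
  rewrite <- !vadd_assoc. f_equal. rewrite !vadd_assoc. f_equal. apply vadd_comm.
Qed.

Lemma vcomb_atom {X : Banach} (n : nat) (l : list X) :
  vcomb (fun i => if Nat.eqb n i then 1 else 0) l = nth n l vzero.
Proof.
  revert n. induction l as [|x l IH]; intros [|n]; simpl; try easy.
  - now rewrite vcomb_0, vscal_1, vadd_0.
  - now rewrite IH, vscal_0l, vadd_0l.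
Qed.

Lemma vden_vcomb {X : Banach} (l : list X) (e : vexp) : vden l e = vcomb (vcoef e) l.
Proof.
  induction e; simpl.
  - symmetry. apply vcomb_atom.
  - symmetry. apply vcomb_0.
  - now rewrite IHe1, IHe2, <- vcomb_add.
  - rewrite IHe, vopp_scal, <- vcomb_scal. apply vcomb_ext, coefs_agree_all. intros; lra.
  - now rewrite IHe, <- vcomb_scal.
Qed.

Lemma vexp_eq {X : Banach} (l : list X) (e f : vexp) :
  coefs_agree (vcoef e) (vcoef f) (length l) -> vden l e = vden l f.
Proof. intros H. rewrite !vden_vcomb. now apply vcomb_ext. Qed.

Ltac vatoms l t :=
  lazymatch t with
  | vadd ?a ?b => let l := vatoms l a in vatoms l b
  | vsub ?a ?b => let l := vatoms l a in vatoms l b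
  | vopp ?a => vatoms l a
  | vscal _ ?a => vatoms l a
  | vzero => l
  | _ => lazymatch l with
         | context [cons t _] => l
         | _ => constr:(cons t l)
         end
  end.

Ltac vindex l t :=
  lazymatch l with
  | cons t _ => constr:(O)
  | cons _ ?l => let n := vindex l t in constr:(S n)
  end.

Ltac vreify l t :=
  lazymatch t with
  | vadd ?a ?b => let e := vreify l a in let f := vreify l b in constr:(VAdd e f)
  | vsub ?a ?b => let e := vreify l a in let f := vreify l b in constr:(VAdd e (VOpp f))
  | vopp ?a => let e := vreify l a in constr:(VOpp e)
  | vscal ?r ?a => let e := vreify l a in constr:(VScal r e)
  | vzero => constr:(VZero)
  | _ => let n := vindex l t in constr:(VAtom n)
  end.

(** Denominators among the scalars leave goals that they do not vanish, which the caller
    discharges. *)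
Ltac vring :=
  lazymatch goal with
  | |- ?a = ?b :> carrier ?X =>
    let l := vatoms (@nil (carrier X)) a in
    let l := vatoms l b in
    let e := vreify l a in
    let f := vreify l b in
    change (vden l e = vden l f);
    apply vexp_eq; cbn [length coefs_agree vcoef Nat.eqb]; repeat split; try field
  end.

(** * Norms and linear functionals *)

Lemma vnorm_0 (X : Banach) : vnorm (@vzero X) = 0.
Proof. rewrite <- (vscal_0l vzero), vnorm_scal, Rabs_R0. lra. Qed.

Lemma vnorm_opp {X : Banach} (x : X) : vnorm (vopp x) = vnorm x.
Proof. rewrite vopp_scal, vnorm_scal, Rabs_left; lra. Qed.

Lemma vnorm_ge0 {X : Banach} (x : X) : 0 <= vnorm x.
Proof.
  pose proof (vnorm_triangle X x (vopp x)) as H.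
  rewrite vadd_opp, vnorm_0, vnorm_opp in H. lra.
Qed.

Lemma vnorm_sub_sym {X : Banach} (x y : X) : vnorm (vsub x y) = vnorm (vsub y x).
Proof. rewrite <- vnorm_opp. f_equal. vring. Qed.

Lemma vnorm_scal_pos {X : Banach} (a : R) (x : X) : 0 <= a -> vnorm (vscal a x) = a * vnorm x.
Proof. intros H. now rewrite vnorm_scal, Rabs_pos_eq. Qed.

Lemma vnorm_triangle_sub {X : Banach} (x y : X) : vnorm (vsub x y) <= vnorm x + vnorm y.
Proof. unfold vsub. rewrite <- (vnorm_opp y). apply vnorm_triangle. Qed.

Lemma vnorm_normalize {X : Banach} (x : X) : 0 < vnorm x -> vnorm (vscal (/ vnorm x) x) = 1.
Proof.
  intros H. rewrite vnorm_scal_pos; [field; lra|]. apply Rlt_le, Rinv_0_lt_compat, H.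
Qed.

Section Functionals.
Context {X : Banach}.
Implicit Types f g L : X -> R.

Lemma linear_opp f x : is_linear X f -> f (vopp x) = - f x.
Proof. intros [_ H]. rewrite vopp_scal, H. lra. Qed.

Lemma linear_sub f x y : is_linear X f -> f (vsub x y) = f x - f y.
Proof. intros H. unfold vsub. rewrite (proj1 H), linear_opp by easy. lra. Qed.

Lemma linear_0 f : is_linear X f -> f vzero = 0.
Proof. intros [_ H]. rewrite <- (vscal_0l vzero), H. lra. Qed.

Lemma bounded_linear_sub f g :
  bounded_linear X f -> bounded_linear X g -> bounded_linear X (fsub X f g).
Proof.
  intros [[Hf1 Hf2] [M HM]] [[Hg1 Hg2] [N HN]]. unfold fsub. split; [split|].
  - intros x y. rewrite Hf1, Hg1. lra.
  - intros a x. rewrite Hf2, Hg2. lra.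
  - exists (M + N). intros x. specialize (HM x). specialize (HN x).
    pose proof (Rabs_triang (f x) (- g x)) as H. rewrite Rabs_Ropp in H.
    unfold Rminus. lra.
Qed.

(** Boundedness gives an upper bound and [f vzero] an element, so a supremum exists and the
    [epsilon] in [dnorm] picks it. *)
Lemma dnorm_lub f : bounded_linear X f ->
  is_lub (fun r => exists x : X, vnorm x <= 1 /\ r = Rabs (f x)) (dnorm X f).
Proof.
  intros [Hl [M HM]]. unfold dnorm. apply epsilon_spec.
  destruct (completeness (fun r => exists x : X, vnorm x <= 1 /\ r = Rabs (f x))) as [m Hm].
  - exists (Rabs M). intros r [x [Hx ->]]. specialize (HM x).
    pose proof (vnorm_ge0 x). pose proof (Rle_abs M). pose proof (Rabs_pos M). nra.
  - exists (Rabs (f vzero)), vzero. split; [rewrite vnorm_0; lra | easy].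
  - now exists m.
Qed.

Lemma dnorm_ge0 f : bounded_linear X f -> 0 <= dnorm X f.
Proof.
  intros Hf. apply Rle_trans with (Rabs (f vzero)); [apply Rabs_pos|].
  apply (dnorm_lub f Hf). exists vzero. split; [rewrite vnorm_0; lra | easy].
Qed.

Lemma dnorm_apply f x : bounded_linear X f -> Rabs (f x) <= dnorm X f * vnorm x.
Proof.
  intros Hf. destruct (vnorm_ge0 x) as [Hx|Hx].
  - assert (H : Rabs (f (vscal (/ vnorm x) x)) <= dnorm X f).
    { apply (dnorm_lub f Hf). exists (vscal (/ vnorm x) x).
      split; [|easy]. rewrite vnorm_normalize; lra. }
    pose proof (Rinv_0_lt_compat _ Hx).
    rewrite (proj2 (proj1 Hf)), Rabs_mult, (Rabs_pos_eq (/ vnorm x)) in H by lra.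
    apply Rmult_le_reg_l with (/ vnorm x); [easy|].
    replace (/ vnorm x * (dnorm X f * vnorm x)) with (dnorm X f) by (field; lra). easy.
  - rewrite <- Hx. symmetry in Hx. apply vnorm_eq0 in Hx. subst x.
    rewrite linear_0 by apply Hf. rewrite Rabs_R0. lra.
Qed.

Lemma dnorm_apply_le f x : bounded_linear X f -> f x <= dnorm X f * vnorm x.
Proof. intros Hf. pose proof (dnorm_apply f x Hf). pose proof (Rle_abs (f x)). lra. Qed.

(** The unit ball is symmetric, so a bound on [f] without absolute value suffices. *)
Lemma dnorm_le f m : bounded_linear X f ->
  (forall x, vnorm x <= 1 -> f x <= m) -> dnorm X f <= m.
Proof.
  intros Hf H. apply (dnorm_lub f Hf). intros r [x [Hx ->]].
  apply Rabs_le. split; [|now apply H].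
  rewrite <- (Ropp_involutive (f x)), <- linear_opp by apply Hf.
  apply Ropp_le_contravar, H. now rewrite vnorm_opp.
Qed.

Lemma dnorm_approx f c : bounded_linear X f -> c < dnorm X f ->
  exists x, vnorm x <= 1 /\ c < f x.
Proof.
  intros Hf Hc. destruct (classic (exists x, vnorm x <= 1 /\ c < f x)) as [|Hn]; [easy|].
  exfalso. apply (Rlt_not_le _ _ Hc), dnorm_le; [easy|]. intros x Hx.
  apply Rnot_lt_le. intros Hx'. apply Hn. now exists x.
Qed.

Lemma dnorm_eq0 f : bounded_linear X f -> (forall x, f x = 0) -> dnorm X f = 0.
Proof.
  intros Hf H. apply Rle_antisym; [|now apply dnorm_ge0].
  apply dnorm_le; [easy|]. intros x _. rewrite H. lra.
Qed.

Lemma bounded_linear_of_unit_ball f B : is_linear X f ->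
  (forall x, vnorm x <= 1 -> f x <= B) -> bounded_linear X f.
Proof.
  intros Hl H. split; [easy|]. exists B. intros x.
  assert (HB : forall x, f x <= B * vnorm x).
  { clear x. intros x. destruct (vnorm_ge0 x) as [Hx|Hx].
    - specialize (H (vscal (/ vnorm x) x)).
      rewrite vnorm_normalize in H by easy. specialize (H (Rle_refl 1)).
      rewrite (proj2 Hl) in H.
      apply Rmult_le_reg_l with (/ vnorm x); [now apply Rinv_0_lt_compat|].
      replace (/ vnorm x * (B * vnorm x)) with B by (field; lra). easy.
    - rewrite <- Hx. symmetry in Hx. apply vnorm_eq0 in Hx. subst x.
      rewrite linear_0 by easy. lra. }
  apply Rabs_le. split; [|apply HB].
  specialize (HB (vopp x)). rewrite vnorm_opp, linear_opp in HB by easy. lra.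
Qed.

End Functionals.

(** * Convex differentiable functions *)

Section Convex.
Context {X : Banach}.
Implicit Types F L : X -> R.

Lemma frechet_deriv_bounds F x L eps : frechet_deriv X F x L -> 0 < eps ->
  exists d, 0 < d /\ forall h, vnorm h < d ->
    F x + L h - eps * vnorm h <= F (vadd x h) <= F x + L h + eps * vnorm h.
Proof.
  intros [_ H] He. destruct (H eps He) as [d [Hd H']]. exists d. split; [easy|].
  intros h Hh. specialize (H' h Hh). pose proof (Rle_abs (F (vadd x h) - F x - L h)) as H1.
  pose proof (Rle_abs (- (F (vadd x h) - F x - L h))) as H2. rewrite Rabs_Ropp in H2. lra.
Qed.

Lemma frechet_continuous F x L eps : frechet_deriv X F x L -> 0 < eps ->
  exists d, 0 < d /\ forall y, vnorm (vsub y x) < d -> Rabs (F y - F x) < eps.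
Proof.
  intros HF He. destruct (frechet_deriv_bounds F x L 1 HF Rlt_0_1) as [d [Hd H]].
  pose proof (dnorm_ge0 L (proj1 HF)) as HL.
  exists (Rmin d (eps / (dnorm X L + 1))). split.
  - apply Rmin_pos; [easy|]. apply Rdiv_lt_0_compat; lra.
  - intros y Hy. specialize (H (vsub y x)).
    replace (vadd x (vsub y x)) with y in H by vring.
    pose proof (Rmin_l d (eps / (dnorm X L + 1))).
    pose proof (Rmin_r d (eps / (dnorm X L + 1))).
    specialize (H ltac:(lra)).
    pose proof (dnorm_apply L (vsub y x) (proj1 HF)) as Ha.
    assert ((dnorm X L + 1) * vnorm (vsub y x) < eps).
    { apply Rlt_le_trans with ((dnorm X L + 1) * (eps / (dnorm X L + 1))).
      - apply Rmult_lt_compat_l; lra.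
      - right. field. lra. }
    pose proof (Rle_abs (L (vsub y x))) as Hu.
    pose proof (Rle_abs (- L (vsub y x))) as Hv. rewrite Rabs_Ropp in Hv.
    apply Rabs_def1; lra.
Qed.

(** Convexity on the segment from [x] to [y] bounds [t (F y - F x)] below by [F (x + t h) - F x],
    which differentiability compares with [t L h]; divide by [t]. *)
Lemma convex_gradient_le F x y L : convex_fun X F -> frechet_deriv X F x L ->
  F x + L (vsub y x) <= F y.
Proof.
  intros Hc HF. apply le_epsilon. intros e He.
  set (h := vsub y x). pose proof (vnorm_ge0 h) as Hh.
  assert (He' : 0 < e / (vnorm h + 1)) by (apply Rdiv_lt_0_compat; lra).
  destruct (frechet_deriv_bounds F x L _ HF He') as [d [Hd H]].
  assert (Hd' : 0 < d / (vnorm h + 1)) by (apply Rdiv_lt_0_compat; lra).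
  set (t := Rmin 1 (d / (vnorm h + 1) / 2)).
  assert (Ht : 0 < t <= 1).
  { split; [apply Rmin_pos; lra | apply Rmin_l]. }
  assert (Ht2 : t * (vnorm h + 1) < d).
  { apply Rlt_le_trans with (d / (vnorm h + 1) * (vnorm h + 1)).
    - apply Rmult_lt_compat_r; [lra|].
      pose proof (Rmin_r 1 (d / (vnorm h + 1) / 2)). unfold t. lra.
    - right. field. lra. }
  specialize (H (vscal t h)). rewrite vnorm_scal_pos in H by lra.
  specialize (H ltac:(lra)).
  rewrite (proj2 (proj1 (proj1 HF))) in H.
  pose proof (Hc y x t ltac:(lra)) as Hc'.
  replace (vadd (vscal t y) (vscal (1 - t) x)) with (vadd x (vscal t h)) in Hc'
    by (unfold h; vring).
  assert (e / (vnorm h + 1) * vnorm h <= e).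
  { replace e with (e / (vnorm h + 1) * (vnorm h + 1)) at 2 by (field; lra).
    apply Rmult_le_compat_l; lra. }
  apply Rmult_le_reg_l with t; [lra|]. nra.
Qed.

(** Let [u] nearly attain the norm [P] of [DF x - DF y], and chain the tangent inequalities from [y]
    to [z = x - r u] and from [z] to [x]. The gain over the tangent at [y] is [r (DF z - DF y) u],
    and Hölder continuity keeps [DF z] close to [DF x]. *)
Lemma convex_gradient_cocoercive alpha F DF : 0 < alpha ->
  convex_fun X F -> C1alpha_fun X alpha F DF ->
  exists k, 0 < k /\ forall x y,
    F y + DF y (vsub x y) + k * pw (dnorm X (fsub X (DF x) (DF y))) (1 + / alpha) <= F x.
Proof.
  intros Ha Hc [HF [K [HK HD]]].
  assert (HK4 : 0 < / (4 * K)) by (apply Rinv_0_lt_compat; lra).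
  exists (/ 4 * pw (/ (4 * K)) (/ alpha)). split.
  { pose proof (pw_gt0 _ (/ alpha) HK4). lra. }
  intros x y.
  pose proof (proj1 (HF x)) as Hx. pose proof (proj1 (HF y)) as Hy.
  pose proof (bounded_linear_sub _ _ Hx Hy) as Hxy.
  destruct (dnorm_ge0 _ Hxy) as [HP|HP].
  2: { rewrite <- HP, (pw_nonpos 0) by lra.
       pose proof (convex_gradient_le F y x (DF y) Hc (HF y)). lra. }
  set (P := dnorm X (fsub X (DF x) (DF y))) in *.
  destruct (dnorm_approx _ (P / 2) Hxy) as [u [Hu HuP]]; [fold P; lra|].
  unfold fsub in HuP.
  (* Solves [K r^alpha = P / 4]: the gradient changes by at most half of the slope gap [P / 2], so
     the gain is at least [r P / 4], a multiple of [P^(1+1/alpha)]. *)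
  set (r := pw (P * / (4 * K)) (/ alpha)).
  assert (Hr : 0 < r) by (apply pw_gt0, Rmult_lt_0_compat; lra).
  assert (Hra : pw r alpha = P * / (4 * K)).
  { apply pw_inv_exponent; [easy|]. apply Rlt_le, Rmult_lt_0_compat; lra. }
  set (z := vsub x (vscal r u)).
  pose proof (convex_gradient_le F y z (DF y) Hc (HF y)) as H1.
  pose proof (convex_gradient_le F z x (DF z) Hc (HF z)) as H2.
  replace (vsub z y) with (vsub (vsub x y) (vscal r u)) in H1 by (unfold z; vring).
  replace (vsub x z) with (vscal r u) in H2 by (unfold z; vring).
  rewrite (linear_sub _ (vsub x y)) in H1 by apply Hy.
  rewrite (proj2 (proj1 Hy)) in H1.
  rewrite (proj2 (proj1 (proj1 (HF z)))) in H2.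
  assert (H3 : DF x u - DF z u <= P / 4).
  { pose proof (bounded_linear_sub _ _ Hx (proj1 (HF z))) as Hxz.
    pose proof (dnorm_apply_le _ u Hxz) as H3. unfold fsub in H3 at 1.
    pose proof (HD x z) as H4.
    pose proof (dnorm_ge0 _ Hxz).
    replace (vsub x z) with (vscal r u) in H4 by (unfold z; vring).
    rewrite vnorm_scal_pos in H4 by lra.
    assert (H5 : pw (r * vnorm u) alpha <= pw r alpha) by (apply pw_le; nra).
    assert (K * pw (r * vnorm u) alpha <= K * (P * / (4 * K)))
      by (apply Rmult_le_compat_l; lra).
    replace (K * (P * / (4 * K))) with (P / 4) in * by (field; lra).
    pose proof (vnorm_ge0 u). nra. }
  assert (H4 : / 4 * pw (/ (4 * K)) (/ alpha) * pw P (1 + / alpha) = r * (P / 4)).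
  { unfold r. rewrite pw_mult, pw_S by lra. field. }
  rewrite H4. nra.
Qed.

(** [x] is the convex combination of [x - t h] and [x + s h] with weights [s / (s + t)] and
    [t / (s + t)]. *)
Lemma convex_slopes F x h s t : convex_fun X F -> 0 < s -> 0 < t ->
  (F x - F (vsub x (vscal t h))) / t <= (F (vadd x (vscal s h)) - F x) / s.
Proof.
  intros Hc Hs Ht.
  assert (Hl : 0 <= s / (s + t) <= 1).
  { split; [apply Rle_mult_inv_pos; lra|].
    apply Rmult_le_reg_r with (s + t); [lra|]. unfold Rdiv.
    rewrite Rmult_assoc, Rinv_l; lra. }
  pose proof (Hc (vsub x (vscal t h)) (vadd x (vscal s h)) _ Hl) as H.
  match type of H with F ?a <= _ => replace a with x in H by (vring; lra) end.
  apply Rmult_le_reg_r with (s * t); [nra|].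
  replace ((F x - F (vsub x (vscal t h))) / t * (s * t))
    with (s * (F x - F (vsub x (vscal t h)))) by (field; lra).
  replace ((F (vadd x (vscal s h)) - F x) / s * (s * t))
    with (t * (F (vadd x (vscal s h)) - F x)) by (field; lra).
  apply Rmult_le_compat_l with (r := s + t) in H; [|lra].
  match type of H with _ <= ?a => replace a
    with (s * F (vsub x (vscal t h)) + t * F (vadd x (vscal s h))) in H by (field; lra) end.
  lra.
Qed.

(** [l] is the left derivative in direction [h], the supremum of the left slopes; every right slope
    bounds these from above. *)
Lemma convex_directional_subgradient F x h : convex_fun X F ->
  exists l, forall t, F x + t * l <= F (vadd x (vscal t h)).
Proof.
  intros Hc.
  destruct (completeness (fun r => exists t, 0 < t /\ r = (F x - F (vsub x (vscal t h))) / t))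
    as [l [Hu Hl]].
  - exists ((F (vadd x (vscal 1 h)) - F x) / 1). intros r [t [Ht ->]].
    apply convex_slopes; [easy | lra | easy].
  - eexists. exists 1. split; [lra | reflexivity].
  - exists l. intros t. destruct (total_order_T t 0) as [[Ht|Ht]|Ht].
    + specialize (Hu ((F x - F (vsub x (vscal (- t) h))) / - t)).
      specialize (Hu ltac:(exists (- t); split; [lra | easy])). simpl in Hu.
      replace (vsub x (vscal (- t) h)) with (vadd x (vscal t h)) in Hu by vring.
      apply Rmult_le_compat_l with (r := - t) in Hu; [|lra].
      replace (- t * ((F x - F (vadd x (vscal t h))) / - t))
        with (F x - F (vadd x (vscal t h))) in Hu by (field; lra).
      lra.
    + subst t. replace (vadd x (vscal 0 h)) with x by vring. lra.
    + specialize (Hl ((F (vadd x (vscal t h)) - F x) / t)).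
      assert (H : l <= (F (vadd x (vscal t h)) - F x) / t).
      { apply Hl. intros r [s [Hs ->]]. now apply convex_slopes. }
      apply Rmult_le_compat_l with (r := t) in H; [|lra].
      replace (t * ((F (vadd x (vscal t h)) - F x) / t))
        with (F (vadd x (vscal t h)) - F x) in H by (field; lra).
      lra.
Qed.

(* The second-difference bound makes the one-sided directional derivatives odd, so the
   directional subgradients already form a linear functional: no Hahn-Banach is needed. *)
Lemma convex_smooth_linear_subgradient alpha F K x : 0 < alpha ->
  convex_fun X F ->
  (forall h, F (vadd x h) + F (vsub x h) - 2 * F x <= K * pw (vnorm h) (1 + alpha)) ->
  exists L, is_linear X L /\
    forall h, F x + L h <= F (vadd x h) <= F x + L h + K * pw (vnorm h) (1 + alpha).
Proof.
  intros Ha Hc HK.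
  destruct (functional_choice _ (fun h => convex_directional_subgradient F x h Hc)) as [L HL].
  (* The subgradient inequality at [- t], inserted in the second-difference bound, gives the
     matching upper estimate at [t]. *)
  assert (HU : forall (h : X) t, F (vadd x (vscal t h))
                 <= F x + t * L h + K * pw (vnorm (vscal t h)) (1 + alpha)).
  { intros h t. specialize (HK (vscal t h)). specialize (HL h (- t)).
    replace (vadd x (vscal (- t) h)) with (vsub x (vscal t h)) in HL by vring. lra. }
  assert (Hpw : forall (h : X) t, 0 < t -> pw (vnorm (vscal t h)) (1 + alpha)
                 = pw t (1 + alpha) * pw (vnorm h) (1 + alpha)).
  { intros h t Ht. rewrite vnorm_scal_pos by lra. apply pw_mult; [lra | apply vnorm_ge0]. }
  (* Both linear expressions approximate the increment of [F] along [t a h] up to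
     [O(t^(1+alpha))]. *)
  assert (Hhom : forall a (h : X), L (vscal a h) = a * L h).
  { intros a h. apply Rle_antisym.
    - apply (pw_le_infinitesimal alpha _ _ (K * pw (vnorm (vscal a h)) (1 + alpha)) Ha).
      intros t Ht. specialize (HL (vscal a h) t). specialize (HU h (t * a)).
      rewrite <- (vscal_assoc X t a h), Hpw in HU by easy. nra.
    - apply (pw_le_infinitesimal alpha _ _ (K * pw (vnorm (vscal a h)) (1 + alpha)) Ha).
      intros t Ht. specialize (HL h (t * a)). specialize (HU (vscal a h) t).
      rewrite <- (vscal_assoc X t a h) in HL. rewrite Hpw in HU by easy. nra. }
  (* [x + t (h + k)] is the midpoint of [x + 2 t h] and [x + 2 t k]. *)
  assert (Hadd : forall h k, L (vadd h k) <= L h + L k).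
  { intros h k.
    apply (pw_le_infinitesimal alpha _ _ (/ 2 * (K * pw (vnorm (vscal 2 h)) (1 + alpha)
      + K * pw (vnorm (vscal 2 k)) (1 + alpha))) Ha).
    intros t Ht. specialize (HL (vadd h k) t).
    pose proof (HU (vscal 2 h) t) as Hh. pose proof (HU (vscal 2 k) t) as Hk.
    rewrite Hpw, Hhom in Hh, Hk by easy.
    pose proof (Hc (vadd x (vscal t (vscal 2 h))) (vadd x (vscal t (vscal 2 k))) (/ 2)
      ltac:(lra)) as H.
    match type of H with F ?a <= _ =>
      replace a with (vadd x (vscal t (vadd h k))) in H by vring end.
    nra. }
  exists L. split; [split|].
  - intros h k. apply Rle_antisym; [apply Hadd|].
    pose proof (Hadd (vscal (-1) h) (vscal (-1) k)) as H.
    rewrite <- vscal_distr_l, !Hhom in H. lra.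
  - apply Hhom.
  - intros h. specialize (HL h 1). specialize (HU h 1). rewrite vscal_1 in HL, HU. lra.
Qed.

(** The linear subgradients are continuous by the local upper bound, and their remainder
    [K |h|^(1+alpha)] makes them Fréchet derivatives. *)
Lemma convex_smooth_C1alpha alpha F K : 0 < alpha -> 0 < K ->
  convex_fun X F ->
  (forall x h, F (vadd x h) + F (vsub x h) - 2 * F x <= K * pw (vnorm h) (1 + alpha)) ->
  (forall x, exists B, forall h, vnorm h <= 1 -> F (vadd x h) <= B) ->
  exists DF, C1alpha_fun X alpha F DF.
Proof.
  intros Ha HK Hc Hs Hb.
  destruct (functional_choice _
    (fun x => convex_smooth_linear_subgradient alpha F K x Ha Hc (Hs x))) as [DF HD].
  assert (Hbl : forall x, bounded_linear X (DF x)).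
  { intros x. destruct (Hb x) as [B HB].
    apply (bounded_linear_of_unit_ball _ (B - F x)); [apply HD|].
    intros h Hh. specialize (HB h Hh). pose proof (proj2 (HD x) h). lra. }
  exists DF. split.
  - intros x. split; [apply Hbl|]. intros eps He.
    assert (HeK : 0 < eps / K) by now apply Rdiv_lt_0_compat.
    exists (pw (eps / K) (/ alpha)). split; [now apply pw_gt0|].
    intros h Hh. pose proof (proj2 (HD x) h) as H. rewrite pw_S in H.
    assert (pw (vnorm h) alpha <= eps / K).
    { rewrite <- (pw_inv_exponent (eps / K) alpha) by lra. apply pw_le; lra. }
    assert (K * pw (vnorm h) alpha <= eps).
    { replace eps with (K * (eps / K)) by (field; lra). apply Rmult_le_compat_l; lra. }
    pose proof (vnorm_ge0 h). rewrite Rabs_pos_eq by lra. nra.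
  - exists (2 * K). split; [lra|]. intros x y.
    apply dnorm_le; [now apply bounded_linear_sub|].
    intros u Hu. unfold fsub.
    destruct (vnorm_ge0 (vsub x y)) as [Hr|Hr].
    2: { symmetry in Hr. rewrite Hr, (pw_nonpos 0) by lra. apply vnorm_eq0 in Hr.
         replace x with y; [lra|]. rewrite <- (vadd_0 X y), <- Hr. vring. }
    set (r := vnorm (vsub x y)) in *.
    (* Hölder bound: estimate [F (y + r u)] above from [y] and below by the tangent at [x], and
       [F y] above from [x]. With [r = |x - y|] this leaves
       [r (DF x - DF y) u <= 2 K r^(1+alpha)]. *)
    pose proof (proj2 (proj2 (HD y) (vscal r u))) as H1.
    pose proof (proj1 (proj2 (HD x) (vadd (vsub y x) (vscal r u)))) as H2.
    pose proof (proj2 (proj2 (HD x) (vsub y x))) as H3.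
    rewrite (proj1 (proj1 (HD x))), (proj2 (proj1 (HD x))) in H2.
    rewrite (proj2 (proj1 (HD y))) in H1.
    replace (vadd x (vadd (vsub y x) (vscal r u))) with (vadd y (vscal r u)) in H2 by vring.
    replace (vadd x (vsub y x)) with y in H3 by vring.
    rewrite (vnorm_sub_sym y x) in H3. fold r in H3.
    rewrite vnorm_scal_pos in H1 by lra.
    assert (H4 : K * pw (r * vnorm u) (1 + alpha) <= K * pw r (1 + alpha)).
    { apply Rmult_le_compat_l; [lra|]. apply pw_le; [lra|].
      pose proof (Rmult_le_compat_l r _ _ (Rlt_le _ _ Hr) Hu). lra. }
    apply Rmult_le_reg_l with r; [easy|].
    rewrite (pw_S r) in H3, H4. lra.
Qed.

End Convex.

(** * Smooth convex envelopes *)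

Lemma convex_fun_scale {X : Banach} (F : X -> R) (a b : R) :
  0 <= a -> convex_fun X F -> convex_fun X (fun x => a * F x + b).
Proof. intros Ha H x y t Ht. specialize (H x y t Ht). nra. Qed.

Lemma convex_fun_translate {X : Banach} (F : X -> R) (h : X) :
  convex_fun X F -> convex_fun X (fun x => F (vadd x h)).
Proof.
  intros H x y t Ht. specialize (H (vadd x h) (vadd y h) t Ht).
  match type of H with F ?a <= _ => match goal with |- F ?b <= _ =>
    replace b with a by vring end end.
  easy.
Qed.

Lemma convex_fun_add {X : Banach} (F G : X -> R) :
  convex_fun X F -> convex_fun X G -> convex_fun X (fun x => F x + G x).
Proof. intros HF HG x y t Ht. specialize (HF x y t Ht). specialize (HG x y t Ht). lra. Qed.

Lemma convex_fun_linear {X : Banach} (L : X -> R) : is_linear X L -> convex_fun X L.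
Proof. intros [H1 H2] x y t _. rewrite H1, !H2. lra. Qed.

Lemma convex_fun_norm (X : Banach) : convex_fun X (fun x => vnorm x).
Proof.
  intros x y t Ht. pose proof (vnorm_triangle X (vscal t x) (vscal (1 - t) y)) as H.
  rewrite !vnorm_scal_pos in H by lra. easy.
Qed.

Section Envelope.
Context {X : Banach} {I : Type} (C : I -> Prop) (G : I -> X -> R).

Definition convex_minorant (phi : X -> R) : Prop :=
  convex_fun X phi /\ forall i, C i -> forall x, phi x <= G i x.

(** As a pointwise supremum it is maximal by definition, so estimates follow by exhibiting convex
    minorants. *)
Definition convex_envelope (x : X) : R :=
  epsilon (inhabits 0) (is_lub (fun r => exists phi, convex_minorant phi /\ r = phi x)).

Hypothesis C_nonempty : exists i, C i.
Hypothesis minorant_exists : exists phi, convex_minorant phi.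

Lemma convex_envelope_lub (x : X) :
  is_lub (fun r => exists phi, convex_minorant phi /\ r = phi x) (convex_envelope x).
Proof.
  unfold convex_envelope. apply epsilon_spec.
  destruct C_nonempty as [i Hi], minorant_exists as [phi0 H0].
  destruct (completeness (fun r => exists phi, convex_minorant phi /\ r = phi x)) as [m Hm].
  - exists (G i x). intros r [phi [[_ H] ->]]. now apply H.
  - now exists (phi0 x), phi0.
  - now exists m.
Qed.

Lemma convex_envelope_max (phi : X -> R) (x : X) :
  convex_minorant phi -> phi x <= convex_envelope x.
Proof. intros H. apply (convex_envelope_lub x). now exists phi. Qed.

Lemma convex_envelope_minorant : convex_minorant convex_envelope.
Proof.
  split.
  - intros x y t Ht. apply (convex_envelope_lub _). intros r [phi [Hphi ->]].
    pose proof (convex_envelope_max phi x Hphi). pose proof (convex_envelope_max phi y Hphi).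
    pose proof (proj1 Hphi x y t Ht). nra.
  - intros i Hi x. apply (convex_envelope_lub _). intros r [phi [[_ Hphi] ->]]. auto.
Qed.

(** The function [z |-> (F (z + h) - A) / B], with [F] the envelope, is a convex minorant and hence
    lies below [F]. *)
Lemma convex_envelope_growth (A B : R) (h : X) : 0 < B ->
  (forall i, C i -> forall x, G i (vadd x h) <= A + B * G i x) ->
  forall x, convex_envelope (vadd x h) <= A + B * convex_envelope x.
Proof.
  intros HB H x. pose proof convex_envelope_minorant as [Hc Hm].
  assert (HB' : / B * B = 1) by (apply Rinv_l; lra).
  pose proof (Rinv_0_lt_compat _ HB) as HB0.
  pose proof (convex_envelope_max (fun z => / B * convex_envelope (vadd z h) + - (/ B * A)) x)
    as Hmax.
  apply Rmult_le_reg_l with (/ B); [easy|].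
  assert (Hconv : convex_fun X (fun z => / B * convex_envelope (vadd z h) + - (/ B * A))).
  { apply (convex_fun_scale (fun z => convex_envelope (vadd z h))); [lra|].
    now apply convex_fun_translate. }
  assert (/ B * convex_envelope (vadd x h) + - (/ B * A) <= convex_envelope x).
  { apply Hmax. split; [easy|]. intros i Hi z.
    pose proof (Rle_trans _ _ _ (Hm i Hi _) (H i Hi z)) as H1.
    apply Rmult_le_compat_l with (r := / B) in H1; [|lra].
    rewrite Rmult_plus_distr_l, <- Rmult_assoc, HB' in H1. lra. }
  rewrite Rmult_plus_distr_l, <- Rmult_assoc, HB'. lra.
Qed.

(* For fixed h the function z |-> (F(z+h) + F(z-h) - q)/2, F being the envelope, is itself
   a convex minorant. *)
Lemma convex_envelope_second_difference (q : R) (h : X) :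
  (forall i, C i -> forall x, G i (vadd x h) + G i (vsub x h) - 2 * G i x <= q) ->
  forall x, convex_envelope (vadd x h) + convex_envelope (vsub x h)
              - 2 * convex_envelope x <= q.
Proof.
  intros H x. pose proof convex_envelope_minorant as [Hc Hm].
  pose proof (convex_envelope_max
    (fun z => / 2 * (convex_envelope (vadd z h) + convex_envelope (vsub z h)) + - (q / 2)) x)
    as Hmax.
  assert (/ 2 * (convex_envelope (vadd x h) + convex_envelope (vsub x h)) + - (q / 2)
            <= convex_envelope x); [|lra].
  apply Hmax. split.
  - apply (convex_fun_scale (fun z => convex_envelope (vadd z h) + convex_envelope (vsub z h)));
      [lra|].
    apply (convex_fun_add (fun z => convex_envelope (vadd z h))); now apply convex_fun_translate.
  - intros i Hi z. pose proof (Hm i Hi (vadd z h)). pose proof (Hm i Hi (vsub z h)).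
    specialize (H i Hi z). lra.
Qed.

End Envelope.

(** For [|x| <= |h|] the triangle inequality suffices. Otherwise scale to [|x| = 1] and expand the
    powers at 1: the modulus of smoothness at [t = |h| / |x|] controls the linear terms, and
    [t^2 <= t^(1+alpha)] the squares. *)
Lemma norm_pw_smooth (X : Banach) (alpha : R) :
  0 < alpha <= 1 -> smoothness_power_type X alpha ->
  exists K, 0 < K /\ forall x h : X,
    pw (vnorm (vadd x h)) (1 + alpha) + pw (vnorm (vsub x h)) (1 + alpha)
      - 2 * pw (vnorm x) (1 + alpha) <= K * pw (vnorm h) (1 + alpha).
Proof.
  intros Ha [K [HK Hs]].
  set (p := 1 + alpha) in *.
  (* [2 * pw 2 p] serves the case [|x| <= |h|]; [4 * K] bounds the linear terms, as [p <= 2], and 2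
     the two squares. *)
  exists (4 * K + 2 + 2 * pw 2 p).
  pose proof (pw_ge0 2 p) as H2.
  split; [lra|]. intros x h.
  pose proof (pw_ge0 (vnorm h) p) as Hh0. pose proof (pw_ge0 (vnorm x) p) as Hx0.
  pose proof (vnorm_ge0 x) as Hx. pose proof (vnorm_ge0 h) as Hh.
  pose proof (vnorm_triangle X x h) as T1. pose proof (vnorm_triangle_sub x h) as T2.
  destruct (Rle_dec (vnorm x) (vnorm h)) as [Hxh|Hxh].
  - pose proof (pw_le _ (2 * vnorm h) p ltac:(unfold p; lra)
      (ltac:(lra) : vnorm (vadd x h) <= 2 * vnorm h)) as B1.
    pose proof (pw_le _ (2 * vnorm h) p ltac:(unfold p; lra)
      (ltac:(lra) : vnorm (vsub x h) <= 2 * vnorm h)) as B2.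
    rewrite pw_mult in B1, B2 by lra. nra.
  - destruct Hh as [Hh|Hh].
    2: { symmetry in Hh. apply vnorm_eq0 in Hh. subst h.
         replace (vadd x vzero) with x by vring. replace (vsub x vzero) with x by vring. nra. }
    set (n := vnorm x) in *. set (m := vnorm h) in *.
    assert (Hn : 0 < n) by lra.
    set (t := m / n).
    assert (Ht : 0 < t <= 1).
    { split; [now apply Rdiv_lt_0_compat|]. apply Rmult_le_reg_r with n; [easy|].
      unfold t. replace (m / n * n) with m by (field; lra). lra. }
    pose proof (Hs t (proj1 Ht) (vscal (/ n) x) (vscal (/ m) h)
      (vnorm_normalize x Hn) (vnorm_normalize h Hh)) as H.
    assert (Hin : 0 < / n) by now apply Rinv_0_lt_compat.
    replace (vadd (vscal (/ n) x) (vscal t (vscal (/ m) h))) with (vscal (/ n) (vadd x h)) in H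
      by (unfold t; vring; lra).
    replace (vsub (vscal (/ n) x) (vscal t (vscal (/ m) h))) with (vscal (/ n) (vsub x h)) in H
      by (unfold t; vring; lra).
    rewrite !vnorm_scal_pos in H by lra.
    assert (L1 : n - m <= vnorm (vadd x h)).
    { pose proof (vnorm_triangle_sub (vadd x h) h) as T.
      replace (vsub (vadd x h) h) with x in T by vring. fold n m in T. lra. }
    assert (L2 : n - m <= vnorm (vsub x h)).
    { pose proof (vnorm_triangle X (vsub x h) h) as T.
      replace (vadd (vsub x h) h) with x in T by vring. fold n m in T. lra. }
    set (a := / n * vnorm (vadd x h)) in *. set (b := / n * vnorm (vsub x h)) in *.
    assert (Ea : vnorm (vadd x h) = n * a) by (unfold a; field; lra).
    assert (Eb : vnorm (vsub x h) = n * b) by (unfold b; field; lra).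
    assert (Em : m = n * t) by (unfold t; field; lra).
    assert (Ba : -t <= a - 1 <= t) by (split; apply Rmult_le_reg_l with n; lra).
    assert (Bb : -t <= b - 1 <= t) by (split; apply Rmult_le_reg_l with n; lra).
    rewrite Ea, Eb, Em, !pw_mult by lra.
    rewrite <- pw_pos in H by easy. fold p in H.
    pose proof (pw_quadratic_bound alpha a Ha ltac:(lra)) as Qa.
    pose proof (pw_quadratic_bound alpha b Ha ltac:(lra)) as Qb.
    pose proof (sqr_le_pw alpha t Ha ltac:(lra)) as Qt. fold p in Qa, Qb, Qt.
    assert (Sa : (a - 1) * (a - 1) <= t * t) by nra.
    assert (Sb : (b - 1) * (b - 1) <= t * t) by nra.
    pose proof (pw_ge0 t p) as Ht0.
    assert (Hp : p * (a + b - 2) <= 2 * (2 * K * pw t p)).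
    { assert (HKt : 0 <= 2 * K * pw t p) by nra.
      assert (p <= 2) by (unfold p; lra). assert (0 < p) by (unfold p; lra).
      apply Rle_trans with (p * (2 * K * pw t p)).
      - apply Rmult_le_compat_l; lra.
      - apply Rmult_le_compat_r; lra. }
    assert (Hab : pw a p + pw b p - 2 <= (4 * K + 2 + 2 * pw 2 p) * pw t p) by nra.
    fold n in Hx0. nra.
Qed.

(** * Sublevel sets of smooth convex functions *)

Section SublevelBody.
Context {X : Banach}.

(** Continuity excludes boundary points with [F x <> 1]. Where [F x = 1], a direction of positive
    slope leaves the sublevel set at once, by the tangent inequality. *)
Lemma sublevel_boundary (F : X -> R) (DF : X -> X -> R) :
  convex_fun X F -> (forall x, frechet_deriv X F x (DF x)) ->
  (forall x, F x = 1 -> 0 < dnorm X (DF x)) ->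
  forall x, boundary X (fun y => F y <= 1) x <-> F x = 1.
Proof.
  intros Hc HF Hpos x. split.
  - intros Hb. destruct (total_order_T (F x) 1) as [[H|H]|H]; [|easy|]; exfalso.
    + destruct (frechet_continuous F x _ (1 - F x) (HF x) ltac:(lra)) as [d [Hd Hd']].
      destruct (Hb d Hd) as [_ [y [Hy HyV]]]. apply HyV.
      specialize (Hd' y Hy). apply Rabs_def2 in Hd'. lra.
    + destruct (frechet_continuous F x _ (F x - 1) (HF x) ltac:(lra)) as [d [Hd Hd']].
      destruct (Hb d Hd) as [[y [Hy HyV]] _].
      specialize (Hd' y Hy). apply Rabs_def2 in Hd'. lra.
  - intros H1 r Hr. split.
    + exists x. split; [|lra]. unfold vsub. rewrite vadd_opp, vnorm_0. easy.
    + destruct (dnorm_approx _ _ (proj1 (HF x)) (Hpos x H1)) as [v [Hv Hv']].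
      exists (vadd x (vscal (r / 2) v)). split.
      * replace (vsub (vadd x (vscal (r / 2) v)) x) with (vscal (r / 2) v) by vring.
        rewrite vnorm_scal_pos by lra. nra.
      * pose proof (convex_gradient_le F x (vadd x (vscal (r / 2) v)) _ Hc (HF x)) as H.
        replace (vsub (vadd x (vscal (r / 2) v)) x) with (vscal (r / 2) v) in H by vring.
        rewrite (proj2 (proj1 (proj1 (HF x)))) in H. nra.
Qed.

Lemma sublevel_C1alpha_body (alpha M : R) (F : X -> R) (DF : X -> X -> R) (c : X) :
  0 < M -> convex_fun X F -> C1alpha_fun X alpha F DF -> F c < 1 ->
  (forall x, F x = 1 -> / M <= dnorm X (DF x) <= M) ->
  C1alpha_body X alpha (fun x => F x <= 1).
Proof.
  intros HM Hc HF Hlt HD.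
  assert (Hb : forall x, boundary X (fun y => F y <= 1) x <-> F x = 1).
  { apply (sublevel_boundary F DF); [easy | apply HF |].
    intros x Hx. pose proof (Rinv_0_lt_compat M HM). specialize (HD x Hx). lra. }
  split; [split; [|split]|].
  - intros u l Hu Hl. apply Rnot_lt_le. intros H.
    destruct (frechet_continuous F l _ (F l - 1) (proj1 HF l) ltac:(lra)) as [d [Hd Hd']].
    destruct (Hl d Hd) as [N HN]. specialize (Hd' (u N) (HN N (le_n N))).
    apply Rabs_def2 in Hd'. specialize (Hu N). lra.
  - intros x y t Hx Hy Ht. specialize (Hc x y t Ht). nra.
  - exists c. destruct (frechet_continuous F c _ (1 - F c) (proj1 HF c) ltac:(lra))
      as [d [Hd Hd']].
    exists d. split; [easy|]. intros y Hy. specialize (Hd' y Hy).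
    apply Rabs_def2 in Hd'. lra.
  - exists M, F, DF. repeat (split; [easy|]). intros x Hx. now apply HD, Hb.
Qed.

End SublevelBody.

(** * Construction of the body *)

Section Bump.
Context {X : Banach}.

(** For [L = D y] this is the function [G_y]. *)
Definition bump (alpha M : R) (L : X -> R) (y x : X) : R :=
  1 + L (vsub x y) + M * pw (vnorm (vsub x y)) (1 + alpha).

(** The power term exceeds [2 |v| - b] for [v = x - y], and the linear term is at least [- |v|]. *)
Lemma bump_coercive (alpha M : R) : 0 < alpha -> 0 < M ->
  exists b, 0 < b /\ forall (L : X -> R) (x y : X),
    bounded_linear X L -> dnorm X L = 1 -> vnorm (vsub x y) <= bump alpha M L y x - 1 + b.
Proof.
  intros Ha HM. destruct (pw_superlinear alpha M Ha HM) as [b [Hb H]].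
  exists b. split; [easy|]. intros L x y HL H1. unfold bump.
  specialize (H _ (vnorm_ge0 (vsub x y))).
  pose proof (dnorm_apply L (vsub x y) HL) as H2. rewrite H1 in H2.
  pose proof (Rle_abs (- L (vsub x y))) as H3. rewrite Rabs_Ropp in H3. lra.
Qed.

Lemma bump_growth (alpha M : R) : 0 < alpha <= 1 -> 0 < M ->
  exists A, forall (L : X -> R) (x y h : X),
    bounded_linear X L -> dnorm X L = 1 -> vnorm h <= 1 ->
    bump alpha M L y (vadd x h) <= A + 9 * bump alpha M L y x.
Proof.
  intros Ha HM. destruct (bump_coercive alpha M (proj1 Ha) HM) as [b [Hb H]].
  (* Of the nine power terms on the right, four pay for the shifted power. The other five, with five
     copies of [L v], give [5 |v| - 5 b] by coercivity, which absorbs the remaining [3 L v]. *)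
  exists (4 * M + 5 * b - 7). intros L x y h HL H1 Hh.
  specialize (H L x y HL H1). unfold bump in *.
  replace (vsub (vadd x h) y) with (vadd (vsub x y) h) by vring.
  set (v := vsub x y) in *. pose proof (vnorm_ge0 v) as Hv.
  rewrite (proj1 (proj1 HL)).
  pose proof (dnorm_apply L v HL) as H2. rewrite H1 in H2.
  pose proof (Rle_abs (- L v)) as H3. rewrite Rabs_Ropp in H3.
  pose proof (dnorm_apply_le L h HL) as H4. rewrite H1 in H4.
  pose proof (vnorm_triangle X v h) as H5.
  pose proof (pw_le _ (vnorm v + 1) (1 + alpha) ltac:(lra)
    (ltac:(lra) : vnorm (vadd v h) <= vnorm v + 1)) as H6.
  pose proof (pw_add1_le alpha (vnorm v) Ha Hv) as H7.
  assert (M * pw (vnorm (vadd v h)) (1 + alpha) <= M * (4 * (pw (vnorm v) (1 + alpha) + 1)))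
    by (apply Rmult_le_compat_l; lra).
  lra.
Qed.

(** Move from [y] by [s] against a direction [u] with [L u > 1/2]: the linear term drops by more
    than [s / 2], while [s] solves [M s^alpha = 1/4], so the power term adds at most [s / 4]. *)
Lemma bump_inner_point (alpha M : R) : 0 < alpha -> 0 < M ->
  exists s eta, 0 < s /\ 0 < eta /\ forall (L : X -> R) (y : X),
    bounded_linear X L -> dnorm X L = 1 ->
    exists c, vnorm (vsub y c) <= s /\ bump alpha M L y c <= 1 - eta.
Proof.
  intros Ha HM.
  assert (H4 : 0 < / (4 * M)) by (apply Rinv_0_lt_compat; lra).
  set (s := pw (/ (4 * M)) (/ alpha)).
  assert (Hs : 0 < s) by now apply pw_gt0.
  exists s, (s / 4). split; [easy|]. split; [lra|]. intros L y HL H1.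
  destruct (dnorm_approx L (/ 2) HL) as [u [Hu HuL]]; [lra|].
  exists (vsub y (vscal s u)). unfold bump.
  replace (vsub y (vsub y (vscal s u))) with (vscal s u) by vring.
  replace (vsub (vsub y (vscal s u)) y) with (vscal (- s) u) by vring.
  rewrite (proj2 (proj1 HL)), !vnorm_scal, Rabs_Ropp, Rabs_pos_eq by lra. pose proof (vnorm_ge0 u).
  assert (Hsu : s * vnorm u <= s) by nra.
  split; [easy|].
  pose proof (pw_le _ _ (1 + alpha) ltac:(lra) Hsu) as H2.
  assert (Hsa : pw s alpha = / (4 * M)) by (apply pw_inv_exponent; lra).
  rewrite (pw_S s), Hsa in H2.
  assert (H3 : M * pw (s * vnorm u) (1 + alpha) <= M * (/ (4 * M) * s))
    by (apply Rmult_le_compat_l; lra).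
  replace (M * (/ (4 * M) * s)) with (s / 4) in H3 by (field; lra).
  nra.
Qed.

End Bump.

(* If the gradient at x with F x = 1 were shorter than c = eta / (2 b), the tangent of F at x
   would stay below 1 - eta/2 + c (G - 1) for every function G of the family; rescaled, it
   would be a convex minorant with value above 1 at x. *)
Lemma convex_envelope_gradient_lower_bound {X : Banach} {I : Type} (J : I -> Prop) (G : I -> X -> R)
  (b eta : R) (L : X -> R) (x : X) :
  (exists i, J i) -> (exists phi, convex_minorant J G phi) ->
  0 < b -> 0 < eta ->
  (forall i, J i -> exists c, G i c <= 1 - eta /\ forall z, vnorm (vsub z c) <= G i z - 1 + b) ->
  frechet_deriv X (convex_envelope J G) x L -> convex_envelope J G x = 1 ->
  eta / (2 * b) <= dnorm X L.
Proof.
  intros HJ Hphi Hb He HG HL Hx. apply Rnot_lt_le. intros Hlt.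
  pose proof (convex_envelope_minorant J G HJ Hphi) as [Hc Hm].
  set (c := eta / (2 * b)) in *.
  assert (Hc0 : 0 < c) by (apply Rdiv_lt_0_compat; lra).
  assert (Hcb : c * b = eta / 2) by (unfold c; field; lra).
  assert (Hmin : convex_minorant J G
            (fun z => / c * L z + (/ c * (eta / 2 - L x) + 1))).
  { split.
    - apply convex_fun_scale; [apply Rlt_le, Rinv_0_lt_compat, Hc0|].
      apply convex_fun_linear, HL.
    - intros i Hi z. destruct (HG i Hi) as [w [Hw Hz]]. specialize (Hz z).
      pose proof (convex_gradient_le _ x w L Hc HL) as H1. rewrite Hx in H1.
      specialize (Hm i Hi w).
      pose proof (dnorm_apply_le L (vsub z w) (proj1 HL)) as H2.
      rewrite linear_sub in H1, H2 by apply HL.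
      pose proof (vnorm_ge0 (vsub z w)).
      assert (dnorm X L * vnorm (vsub z w) <= c * (G i z - 1 + b)) by nra.
      apply Rmult_le_reg_l with c; [easy|].
      replace (c * (/ c * L z + (/ c * (eta / 2 - L x) + 1)))
        with (L z + eta / 2 - L x + c) by (field; lra).
      lra. }
  pose proof (convex_envelope_max J G HJ Hphi _ x Hmin) as H. simpl in H. rewrite Hx in H.
  assert (0 < / c * (eta / 2)) by (apply Rmult_lt_0_compat; [now apply Rinv_0_lt_compat | lra]).
  lra.
Qed.

Section Construction.
Context {X : Banach} (alpha : R) (C : X -> Prop) (D : X -> X -> R).
Hypothesis alpha_range : 0 < alpha <= 1.
Hypothesis D_sphere : maps_to_dual_sphere X C D.

(** The bump at [y] minus the tangent at [z] is [(D y - D z)(x - y) + D z (z - y) + M |x -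
    y|^(1+alpha)]. Condition (2) bounds the middle term below, and Young's inequality then absorbs
    the first. *)
Lemma bump_above_tangents (delta M : R) :
  (forall d r, 0 <= d -> 0 <= r ->
     d * r <= delta * pw d (1 + / alpha) + M * pw r (1 + alpha)) ->
  (forall x y, C x -> C y ->
     D y (vsub y x) >= delta * pw (dnorm X (fsub X (D x) (D y))) (1 + / alpha)) ->
  forall z, C z ->
    convex_minorant C (fun y => bump alpha M (D y) y) (fun x => 1 + D z (vsub x z)).
Proof.
  intros HY H2 z Hz. destruct (D_sphere z Hz) as [Hbz _]. split.
  - intros x y t Ht. rewrite !linear_sub by apply Hbz.
    pose proof (convex_fun_linear _ (proj1 Hbz) x y t Ht). nra.
  - intros y Hy x. destruct (D_sphere y Hy) as [Hby _]. unfold bump.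
    specialize (H2 y z Hy Hz).
    pose proof (bounded_linear_sub _ _ Hby Hbz) as Hb.
    pose proof (HY _ _ (dnorm_ge0 _ Hb) (vnorm_ge0 (vsub x y))) as HY'.
    pose proof (dnorm_apply _ (vsub x y) Hb) as Ha.
    unfold fsub in Ha at 1.
    pose proof (Rle_abs (- (D y (vsub x y) - D z (vsub x y)))) as H3. rewrite Rabs_Ropp in H3.
    rewrite !(linear_sub (D z)) in * by apply Hbz. lra.
Qed.

Lemma body_of_cond2 :
  smoothness_power_type X alpha -> (exists y, C y) -> cond2 X alpha C D ->
  exists V, cond1_body X alpha C D V /\ (bounded_set X C -> bounded_set X V).
Proof.
  intros Hsm HC [delta [Hdelta H2]].
  destruct (young_pw alpha delta (proj1 alpha_range) Hdelta) as [M [HM HY]].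
  destruct (norm_pw_smooth X alpha alpha_range Hsm) as [K [HK HKs]].
  set (G := fun y => bump alpha M (D y) y).
  pose proof (bump_above_tangents delta M HY H2 : forall z, C z -> convex_minorant C G _) as Htan.
  destruct (bump_coercive (X := X) alpha M (proj1 alpha_range) HM) as [b [Hb Hcoer]].
  destruct (bump_growth (X := X) alpha M alpha_range HM) as [A Hgrow].
  destruct (bump_inner_point (X := X) alpha M (proj1 alpha_range) HM)
    as [s [eta [Hs [Heta Hinner]]]].
  assert (Hmin : exists phi, convex_minorant C G phi).
  { destruct HC as [y Hy]. eexists. apply (Htan y Hy). }
  set (F := convex_envelope C G).
  pose proof (convex_envelope_minorant C G HC Hmin : convex_minorant C G F) as [Fconv FG].
  assert (Fgrow : forall h, vnorm h <= 1 -> forall x, F (vadd x h) <= A + 9 * F x).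
  { intros h Hh. apply convex_envelope_growth; [easy | easy | lra |].
    intros y Hy x. now apply Hgrow; try apply D_sphere. }
  assert (Fsmooth : forall x h, F (vadd x h) + F (vsub x h) - 2 * F x
            <= M * K * pw (vnorm h) (1 + alpha)).
  { intros x h. apply convex_envelope_second_difference; [easy | easy |].
    clear x. intros y Hy x. destruct (D_sphere y Hy) as [[[Hadd _] _] _].
    assert (Hl := proj1 (proj1 (D_sphere y Hy))). unfold G, bump.
    replace (vsub (vadd x h) y) with (vadd (vsub x y) h) by vring.
    replace (vsub (vsub x h) y) with (vsub (vsub x y) h) by vring.
    rewrite Hadd, (linear_sub _ (vsub x y) h Hl).
    specialize (HKs (vsub x y) h). apply Rmult_le_compat_l with (r := M) in HKs; lra. }
  (* Coercivity recentred at the inner point [c], at the cost of [s], as the gradient lower bound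
     requires. *)
  assert (Hinner' : forall y, C y -> exists c, G y c <= 1 - eta /\
            forall z, vnorm (vsub z c) <= G y z - 1 + (b + s)).
  { intros y Hy. destruct (D_sphere y Hy) as [Hby Hny].
    destruct (Hinner (D y) y Hby Hny) as [c [Hc1 Hc2]]. exists c. split; [easy|].
    intros z. specialize (Hcoer (D y) z y Hby Hny).
    pose proof (vnorm_triangle X (vsub z y) (vsub y c)) as T.
    replace (vadd (vsub z y) (vsub y c)) with (vsub z c) in T by vring. unfold G. lra. }
  destruct (convex_smooth_C1alpha alpha F (M * K) (proj1 alpha_range)) as [DF HDF];
    [nra | easy | easy | |].
  { intros x. exists (A + 9 * F x). auto. }
  assert (Fone : forall z, C z -> F z = 1).
  { intros z Hz. apply Rle_antisym.
    - specialize (FG z Hz z). unfold G, bump in FG.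
      replace (vsub z z) with (@vzero X) in FG by vring.
      rewrite vnorm_0, linear_0, pw_nonpos in FG by (lra || apply (D_sphere z Hz)). lra.
    - pose proof (convex_envelope_max C G HC Hmin _ z (Htan z Hz)) as H. simpl in H.
      rewrite linear_sub in H by apply (D_sphere z Hz). unfold F. lra. }
  assert (Ftan : forall z x, C z -> 1 + D z x - D z z <= F x).
  { intros z x Hz. pose proof (convex_envelope_max C G HC Hmin _ x (Htan z Hz)) as H.
    simpl in H. rewrite linear_sub in H by apply (D_sphere z Hz). unfold F. lra. }
  set (c0 := eta / (2 * (b + s))).
  assert (Hc0 : 0 < c0) by (apply Rdiv_lt_0_compat; lra).
  (* Large enough for both sides: [c0] bounds the gradient below, and [Fgrow] with [F x = 1] bounds
     it above by [A + 8]. *)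
  set (M' := / c0 + (Rabs A + 9)).
  assert (HM' : / c0 <= M') by (pose proof (Rabs_pos A); unfold M'; lra).
  assert (HM0 : 0 < M').
  { pose proof (Rinv_0_lt_compat _ Hc0). lra. }
  assert (HDb : forall x, F x = 1 -> / M' <= dnorm X (DF x) <= M').
  { intros x Hx. split.
    - apply Rle_trans with c0.
      + rewrite <- (Rinv_inv c0). apply Rinv_le_contravar; [now apply Rinv_0_lt_compat | easy].
      + apply (convex_envelope_gradient_lower_bound C G (b + s) eta (DF x) x);
          try easy; [lra | apply HDF].
    - apply dnorm_le; [apply HDF|]. intros h Hh.
      specialize (Fgrow h Hh x).
      pose proof (convex_gradient_le F x (vadd x h) _ Fconv (proj1 HDF x)) as H.
      replace (vsub (vadd x h) x) with h in H by vring.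
      pose proof (Rle_abs A). pose proof (Rinv_0_lt_compat _ Hc0). unfold M'. lra. }
  destruct HC as [y0 Hy0]. destruct (Hinner' y0 Hy0) as [c [Hc _]].
  pose proof (FG y0 Hy0 c) as Hc'.
  assert (HFpos : forall x, F x = 1 -> 0 < dnorm X (DF x)).
  { intros x Hx. pose proof (Rinv_0_lt_compat _ HM0). specialize (HDb x Hx). lra. }
  pose proof (sublevel_boundary F DF Fconv (proj1 HDF) HFpos) as Hbd.
  exists (fun x => F x <= 1). split; [split; [|split]|].
  - apply (sublevel_C1alpha_body alpha M' F DF c); try easy. lra.
  - intros x Hx. now apply Hbd, Fone.
  - intros x Hx. split; [split|].
    + now apply Hbd, Fone.
    + intros eps He.
      (* At a boundary point [F y = 1], so the squeeze puts [D x y - D x x] between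
         [- M |y - x|^(1+alpha)] and 0; the radius makes [M |y - x|^alpha <= eps]. *)
      assert (HeM : 0 < eps / M) by now apply Rdiv_lt_0_compat.
      exists (pw (eps / M) (/ alpha)). split; [now apply pw_gt0|].
      intros y Hy Hyx. apply Hbd in Hy.
      pose proof (Ftan x y Hx) as H3. pose proof (FG x Hx y) as H4. unfold G, bump in H4.
      rewrite linear_sub in H4 by apply (D_sphere x Hx).
      rewrite pw_S in H4.
      assert (H5 : pw (vnorm (vsub y x)) alpha <= eps / M).
      { rewrite <- (pw_inv_exponent (eps / M) alpha) by lra. apply pw_le; lra. }
      apply Rmult_le_compat_l with (r := M) in H5; [|lra].
      replace (M * (eps / M)) with eps in H5 by (field; lra).
      pose proof (vnorm_ge0 (vsub y x)).
      apply Rabs_le. nra.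
    + intros y Hy. specialize (Ftan x y Hx). lra.
  - intros [Q HQ]. exists (Q + b).
    (* For [C] inside the ball of radius [Q], coercivity puts this shifted norm below every bump;
       maximality of [F] then bounds [|x|] by [Q + b] on [F <= 1]. *)
    assert (Hnorm : convex_minorant C G (fun x => 1 * vnorm x + (1 - b - Q))).
    { split; [apply convex_fun_scale; [lra | apply convex_fun_norm]|].
      intros y Hy x. destruct (D_sphere y Hy) as [Hby Hny].
      specialize (Hcoer (D y) x y Hby Hny). specialize (HQ y Hy).
      pose proof (vnorm_triangle X (vsub x y) y) as T.
      replace (vadd (vsub x y) y) with x in T by vring. unfold G. lra. }
    intros x Hx.
    pose proof (convex_envelope_max C G (ex_intro _ y0 Hy0) Hmin _ x Hnorm) as H. simpl in H.
    fold F in H. lra.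
Qed.

End Construction.

(** The tangent inequality at 0 gives [L x >= |x|]; at [x + h], with the triangle inequality, it
    gives [L h <= |h|]. *)
Lemma norm_deriv_support {X : Banach} (x : X) (L : X -> R) :
  x <> vzero -> frechet_deriv X (fun y => vnorm y) x L -> dnorm X L = 1.
Proof.
  intros Hx HL.
  assert (Hn : 0 < vnorm x).
  { destruct (vnorm_ge0 x) as [H|H]; [easy|]. now symmetry in H; apply vnorm_eq0 in H. }
  pose proof (convex_gradient_le _ x vzero L (convex_fun_norm X) HL) as H1. simpl in H1.
  rewrite linear_sub, linear_0, vnorm_0 in H1 by apply HL.
  apply Rle_antisym.
  - apply dnorm_le; [apply HL|]. intros h Hh.
    pose proof (convex_gradient_le _ x (vadd x h) L (convex_fun_norm X) HL) as H2. simpl in H2.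
    replace (vsub (vadd x h) x) with h in H2 by vring.
    pose proof (vnorm_triangle X x h). lra.
  - pose proof (dnorm_apply_le L x (proj1 HL)).
    apply Rmult_le_reg_r with (vnorm x); lra.
Qed.

Lemma body_of_cond2_all {X : Banach} (alpha : R) (C : X -> Prop) (D : X -> X -> R) :
  0 < alpha <= 1 -> norm_differentiable X -> smoothness_power_type X alpha ->
  maps_to_dual_sphere X C D -> cond2 X alpha C D ->
  exists V, cond1_body X alpha C D V /\ (bounded_set X C -> bounded_set X V).
Proof.
  intros Ha Hnd Hsm HD H2.
  destruct (classic (exists y, C y)) as [HC|HC]; [now apply body_of_cond2|].
  assert (Hempty : forall x, ~ C x) by (intros x Hx; apply HC; now exists x).
  destruct (classic (exists x : X, x <> vzero)) as [[x0 Hx0]|H0].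
  - destruct (Hnd x0 Hx0) as [L HL].
    pose proof (norm_deriv_support x0 L Hx0 HL) as HL1.
    destruct (body_of_cond2 alpha (fun x => x = x0) (fun _ => L)) as [V [[HV _] HVb]];
      [easy | now split; [apply HL|] | easy | now exists x0 | |].
    + exists 1. split; [lra|]. intros x y -> ->.
      rewrite dnorm_eq0, pw_nonpos, linear_sub; try lra; try apply HL.
      * apply bounded_linear_sub; apply HL.
      * intros z. unfold fsub. lra.
    + exists V. split.
      * split; [easy|]. split; intros x Hx; now apply Hempty in Hx.
      * intros _. apply HVb. exists (vnorm x0). intros x ->. lra.
  (* In the zero space no unit functional exists. The whole space serves: its boundary is empty,
     which matches [F = 0] never taking the value 1. *)
  - assert (Hall : forall x : X, x = vzero).
    { intros x. apply NNPP. intros Hx. apply H0. now exists x. }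
    assert (Hz : bounded_linear X (fun _ => 0)).
    { split; [split; intros; lra|]. exists 0. intros x. rewrite Rabs_R0. lra. }
    assert (Hb : forall x, boundary X (fun _ => True) x <-> 0 = 1).
    { intros x. split; [|lra]. intros H. now destruct (H 1 Rlt_0_1) as [_ [y [_ []]]]. }
    exists (fun _ => True). split.
    + split; [|split; intros x Hx; now apply Hempty in Hx].
      split; [split; [|split]; try easy; exists vzero, 1; split; [lra | easy]|].
      exists 1, (fun _ => 0), (fun _ _ => 0). split; [lra|]. split; [|split; [|split]].
      * intros x y t _. lra.
      * split.
        -- intros x. split; [easy|]. intros eps He. exists 1. split; [lra|]. intros h _.
           rewrite !Rminus_0_r, Rabs_R0. pose proof (vnorm_ge0 h). nra.
        -- exists 1. split; [lra|]. intros x y.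
           rewrite dnorm_eq0; [pose proof (pw_ge0 (vnorm (vsub x y)) alpha); lra | |].
           ++ now apply bounded_linear_sub.
           ++ intros z. unfold fsub. lra.
      * easy.
      * intros x Hx. apply Hb in Hx. lra.
    + intros _. exists 0. intros x _. rewrite (Hall x), vnorm_0. lra.
Qed.

(** * Normals of smooth convex bodies *)

Section Normals.
Context {X : Banach}.

Lemma boundary_of_closed (V : X -> Prop) (x : X) : closed_set X V -> boundary X V x -> V x.
Proof.
  intros HV Hb.
  assert (H : forall n : nat, exists y, vnorm (vsub y x) < / (INR n + 1) /\ V y).
  { intros n. apply Hb, Rinv_0_lt_compat. pose proof (pos_INR n). lra. }
  destruct (functional_choice _ H) as [u Hu].
  apply (HV u); [apply Hu|]. intros eps He.
  destruct (archimed_cor1 eps He) as [N [HN HN0]].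
  exists N. intros n Hn. apply Rlt_trans with (2 := HN).
  apply Rlt_le_trans with (1 := proj1 (Hu n)).
  apply Rinv_le_contravar; [now apply lt_0_INR|].
  apply le_INR in Hn. lra.
Qed.

Lemma frechet_continuous_line (F : X -> R) (DF : X -> X -> R) (w v : X) (c : R) :
  (forall x, frechet_deriv X F x (DF x)) -> continuity (fun s => F (vadd w (vscal s v)) - c).
Proof.
  intros HF s0 eps He.
  destruct (frechet_continuous F (vadd w (vscal s0 v)) _ eps (HF _) He) as [d [Hd Hd']].
  pose proof (vnorm_ge0 v) as Hv.
  exists (d / (vnorm v + 1)). split; [apply Rdiv_lt_0_compat; lra|].
  intros s [_ Hs]. simpl in *. unfold Rdist in *.
  replace (F (vadd w (vscal s v)) - c - (F (vadd w (vscal s0 v)) - c))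
    with (F (vadd w (vscal s v)) - F (vadd w (vscal s0 v))) by ring.
  apply Hd'.
  replace (vsub (vadd w (vscal s v)) (vadd w (vscal s0 v))) with (vscal (s - s0) v) by vring.
  rewrite vnorm_scal. apply Rmult_lt_compat_r with (r := vnorm v + 1) in Hs; [|lra].
  replace (d / (vnorm v + 1) * (vnorm v + 1)) with d in Hs by (field; lra).
  pose proof (Rabs_pos (s - s0)). nra.
Qed.

(* For h in the kernel of the gradient, the intermediate value theorem on a short segment
   x + t h + [-eps t, eps t] v transversal to the level set gives points of the level set
   tangent to h to first order. *)
Lemma support_nonpos_on_kernel (F N : X -> R) (DF : X -> X -> R) (x v h : X) :
  (forall y, frechet_deriv X F y (DF y)) -> bounded_linear X N -> 0 < DF x v ->
  (forall y, F y = F x -> N y <= N x) -> DF x h = 0 -> N h <= 0.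
Proof.
  intros HF HN Hv Hle Hh. apply Rnot_lt_le. intros Hpos.
  (* A correction [s v] with [|s| <= e t] cannot cancel the growth [t N h] of [N]. *)
  set (e := N h / (2 * (Rabs (N v) + 1))).
  assert (He : 0 < e) by (pose proof (Rabs_pos (N v)); apply Rdiv_lt_0_compat; lra).
  assert (HeN : e * Rabs (N v) < N h).
  { pose proof (Rabs_pos (N v)).
    assert (e * (2 * (Rabs (N v) + 1)) = N h) by (unfold e; field; lra). nra. }
  set (m := vnorm h + e * vnorm v + 1).
  pose proof (vnorm_ge0 h) as Hh0. pose proof (vnorm_ge0 v) as Hv0.
  assert (Hm : 1 <= m) by (unfold m; nra).
  (* With this tolerance the first-order error is at most half of [e t DF x v], so [F - F x] changes
     sign between the ends of the segment. *)
  assert (Heps : 0 < e * DF x v / (2 * m)) by (apply Rdiv_lt_0_compat; nra).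
  destruct (frechet_deriv_bounds F x _ _ (HF x) Heps) as [d [Hd Hb]].
  set (t := d / (2 * m)).
  assert (Ht : 0 < t) by (apply Rdiv_lt_0_compat; lra).
  assert (Htm : t * m < d).
  { unfold t. replace (d / (2 * m) * m) with (d / 2) by (field; lra). lra. }
  assert (Hend : forall s, Rabs s = e * t ->
            F x + s * DF x v - e * t * DF x v / 2 <= F (vadd (vadd x (vscal t h)) (vscal s v))
            <= F x + s * DF x v + e * t * DF x v / 2).
  { intros s Hs. specialize (Hb (vadd (vscal t h) (vscal s v))).
    pose proof (vnorm_triangle X (vscal t h) (vscal s v)) as T.
    rewrite !vnorm_scal, Hs, (Rabs_pos_eq t) in T by lra.
    assert (T' : vnorm (vadd (vscal t h) (vscal s v)) <= t * m) by (unfold m; nra).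
    specialize (Hb ltac:(lra)).
    rewrite (proj1 (proj1 (proj1 (HF x)))), !(proj2 (proj1 (proj1 (HF x)))), Hh in Hb.
    replace (vadd x (vadd (vscal t h) (vscal s v)))
      with (vadd (vadd x (vscal t h)) (vscal s v)) in Hb by vring.
    apply Rmult_le_compat_l with (r := e * DF x v / (2 * m)) in T'; [|lra].
    replace (e * DF x v / (2 * m) * (t * m)) with (e * t * DF x v / 2) in T' by (field; lra).
    lra. }
  assert (Het : 0 < e * t) by nra.
  pose proof (Hend (- (e * t)) ltac:(rewrite Rabs_Ropp; apply Rabs_pos_eq; lra)) as H1.
  pose proof (Hend (e * t) ltac:(apply Rabs_pos_eq; lra)) as H2.
  assert (Hetv : 0 < e * t * DF x v) by nra.
  destruct (IVT _ (- (e * t)) (e * t)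
    (frechet_continuous_line F DF (vadd x (vscal t h)) v (F x) HF)) as [s [Hs Hs0]];
    [lra | lra | lra |].
  assert (HFs : F (vadd (vadd x (vscal t h)) (vscal s v)) = F x) by lra.
  apply Hle in HFs.
  rewrite !(proj1 (proj1 HN)), !(proj2 (proj1 HN)) in HFs.
  assert (- s * N v <= e * t * Rabs (N v)).
  { apply Rle_trans with (1 := Rle_abs _). rewrite Rabs_mult, Rabs_Ropp.
    apply Rmult_le_compat_r; [apply Rabs_pos|]. apply Rabs_le. lra. }
  nra.
Qed.

(** Applied to [k] and [- k], the previous lemma makes [N] vanish on the kernel of [DF x]; [k] is
    the projection of [h] to this kernel along [v]. *)
Lemma support_proportional_to_gradient (F N : X -> R) (DF : X -> X -> R) (x : X) :
  (forall y, frechet_deriv X F y (DF y)) -> bounded_linear X N -> 0 < dnorm X (DF x) ->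
  (forall y, F y = F x -> N y <= N x) -> exists a, forall h, N h = a * DF x h.
Proof.
  intros HF HN Hpos Hle.
  destruct (dnorm_approx _ _ (proj1 (HF x)) Hpos) as [v [_ Hv]].
  pose proof (proj1 (proj1 (HF x))) as HL.
  exists (N v / DF x v). intros h.
  set (k := vsub h (vscal (DF x h / DF x v) v)).
  assert (Hk : DF x k = 0).
  { unfold k. rewrite linear_sub, (proj2 HL) by easy. field. lra. }
  assert (Hk' : DF x (vopp k) = 0) by (rewrite linear_opp, Hk by easy; lra).
  pose proof (support_nonpos_on_kernel F N DF x v k HF HN Hv Hle Hk) as H1.
  pose proof (support_nonpos_on_kernel F N DF x v (vopp k) HF HN Hv Hle Hk') as H2.
  rewrite linear_opp in H2 by apply HN.
  assert (H3 : N k = 0) by lra. unfold k in H3.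
  rewrite linear_sub, (proj2 (proj1 HN)) in H3 by apply HN.
  replace (N v / DF x v * DF x h) with (DF x h / DF x v * N v) by (field; lra). lra.
Qed.

Lemma dnorm_scal (f g : X -> R) (a : R) :
  bounded_linear X f -> bounded_linear X g -> (forall h, f h = a * g h) ->
  dnorm X f = Rabs a * dnorm X g.
Proof.
  intros Hf Hg H.
  assert (Hle : dnorm X f <= Rabs a * dnorm X g).
  { apply dnorm_le; [easy|]. intros x Hx. rewrite H.
    apply Rle_trans with (1 := Rle_abs _). rewrite Rabs_mult.
    apply Rmult_le_compat_l; [apply Rabs_pos|].
    pose proof (dnorm_apply g x Hg). pose proof (dnorm_ge0 g Hg). nra. }
  apply Rle_antisym; [easy|].
  destruct (Req_dec a 0) as [->|Ha].
  - rewrite Rabs_R0, Rmult_0_l. now apply dnorm_ge0.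
  - assert (Ha' : 0 < Rabs a) by now apply Rabs_pos_lt.
    apply Rmult_le_reg_l with (/ Rabs a); [now apply Rinv_0_lt_compat|].
    rewrite <- Rmult_assoc, Rinv_l, Rmult_1_l by lra.
    apply dnorm_le; [easy|]. intros x Hx.
    apply Rmult_le_reg_l with (Rabs a); [easy|].
    rewrite <- Rmult_assoc, Rinv_r, Rmult_1_l by lra.
    apply Rle_trans with (Rabs (f x)).
    + rewrite H, Rabs_mult. apply Rmult_le_compat_l; [lra | apply Rle_abs].
    + pose proof (dnorm_apply f x Hf). pose proof (dnorm_ge0 f Hf). nra.
Qed.

Lemma linear_constant_on_body (V : X -> Prop) (L : X -> R) (k : R) (h : X) :
  (exists c, interior_point X V c) -> is_linear X L -> (forall z, V z -> L z = k) -> L h = 0.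
Proof.
  intros [c [r [Hr Hc]]] HL Hk. pose proof (vnorm_ge0 h) as Hh.
  assert (Ht : 0 < r / (vnorm h + 1)) by (apply Rdiv_lt_0_compat; lra).
  set (t := r / (vnorm h + 1)) in *.
  assert (Hth : t * (vnorm h + 1) = r) by (unfold t; field; lra).
  assert (H1 : V c).
  { apply Hc. unfold vsub. now rewrite vadd_opp, vnorm_0. }
  assert (H2 : V (vadd c (vscal t h))).
  { apply Hc. replace (vsub (vadd c (vscal t h)) c) with (vscal t h) by vring.
    rewrite vnorm_scal_pos; nra. }
  apply Hk in H1, H2. rewrite (proj1 HL), (proj2 HL) in H2. nra.
Qed.

(** Split [a f - b g = a (f - g) + (a - b) g]. By the normalizations [(a - b) |g| = a (|g| - |f|)],
    so each part is at most [a |f - g|]. *)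
Lemma normalized_difference (f g : X -> R) (a b : R) :
  bounded_linear X f -> bounded_linear X g -> 0 < a ->
  a * dnorm X f = 1 -> b * dnorm X g = 1 ->
  forall u, vnorm u <= 1 -> a * f u - b * g u <= 2 * a * dnorm X (fsub X f g).
Proof.
  intros Hf Hg Ha Hfa Hgb u Hu.
  pose proof (bounded_linear_sub f g Hf Hg) as Hfg.
  set (P := dnorm X (fsub X f g)).
  assert (Hd : forall w, vnorm w <= 1 -> Rabs (f w - g w) <= P).
  { intros w Hw. pose proof (dnorm_apply _ w Hfg) as H. unfold fsub in H at 1.
    fold P in H. pose proof (dnorm_ge0 _ Hfg) as H0. fold P in H0. nra. }
  assert (H1 : dnorm X f <= dnorm X g + P).
  { apply dnorm_le; [easy|]. intros w Hw.
    pose proof (dnorm_apply_le g w Hg). pose proof (dnorm_ge0 g Hg).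
    pose proof (Rle_trans _ _ _ (Rle_abs _) (Hd w Hw)). nra. }
  assert (H2 : dnorm X g <= dnorm X f + P).
  { apply dnorm_le; [easy|]. intros w Hw.
    pose proof (dnorm_apply_le f w Hf). pose proof (dnorm_ge0 f Hf).
    pose proof (Hd w Hw) as Hs. rewrite Rabs_minus_sym in Hs.
    pose proof (Rle_trans _ _ _ (Rle_abs _) Hs). nra. }
  assert (H3 : a * (f u - g u) <= a * P).
  { apply Rmult_le_compat_l; [lra|]. apply Rle_trans with (1 := Rle_abs _). auto. }
  assert (H4 : (a - b) * g u <= a * P).
  { apply Rle_trans with (1 := Rle_abs _). rewrite Rabs_mult.
    pose proof (dnorm_apply g u Hg). pose proof (dnorm_ge0 g Hg).
    apply Rle_trans with (Rabs (a - b) * dnorm X g).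
    - apply Rmult_le_compat_l; [apply Rabs_pos | nra].
    - rewrite <- (Rabs_pos_eq (dnorm X g)), <- Rabs_mult by easy. apply Rabs_le.
      replace ((a - b) * dnorm X g) with (a * (dnorm X g - dnorm X f)) by lra. nra. }
  lra.
Qed.

Lemma cond2_of_body (alpha : R) (C : X -> Prop) (D : X -> X -> R) (V : X -> Prop) :
  0 < alpha <= 1 -> maps_to_dual_sphere X C D -> cond1_body X alpha C D V ->
  cond2 X alpha C D.
Proof.
  intros Ha HD [[[Hcl [_ Hint]] [M [F [DF [HM [Hc [HF [Hb HDF]]]]]]]] [HCb Hsup]].
  destruct (convex_gradient_cocoercive alpha F DF (proj1 Ha) Hc HF) as [k [Hk Hcoco]].
  pose proof (proj1 HF) as HFd.
  assert (HC1 : forall x, C x -> F x = 1) by (intros x Hx; now apply Hb, HCb).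
  assert (HCV : forall x, C x -> V x) by (intros x Hx; now apply boundary_of_closed; [|apply HCb]).
  assert (Hpos : forall x, C x -> / M <= dnorm X (DF x) <= M) by (intros x Hx; now apply HDF, HCb).
  pose proof (Rinv_0_lt_compat M HM) as HMi.
  (* The premise [C x] stands under the existential so that choice yields a multiplier for every
     point of [X], with the default 0 off [C]. *)
  assert (Hprop : forall x, exists a, C x ->
            (forall h, D x h = a * DF x h) /\ Rabs a * dnorm X (DF x) = 1).
  { intros x. destruct (classic (C x)) as [Hx|Hx]; [|now exists 0].
    destruct (HD x Hx) as [HDx HDx1]. pose proof (Hpos x Hx).
    destruct (support_proportional_to_gradient F (D x) DF x HFd HDx ltac:(lra)) as [a Hprop].
    - intros y Hy. rewrite (HC1 x Hx) in Hy. apply Hsup; [easy|].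
      now apply boundary_of_closed, Hb.
    - exists a. intros _. split; [easy|]. rewrite <- HDx1. symmetry.
      now apply dnorm_scal; [|apply HFd|]. }
  destruct (functional_choice _ Hprop) as [a Hax]. clear Hprop.
  assert (Hgap : forall x y, C x -> C y ->
            k * pw (dnorm X (fsub X (DF x) (DF y))) (1 + / alpha) <= DF y (vsub y x)).
  { intros x y Hx Hy. specialize (Hcoco x y). rewrite !HC1 in Hcoco by easy.
    rewrite linear_sub in * by apply HFd. lra. }
  assert (Hside : forall x y, C x -> C y -> 0 <= a y * DF y (vsub y x)).
  { intros x y Hx Hy. pose proof (proj2 (Hsup y Hy) x (HCV x Hx)) as H.
    rewrite !(proj1 (Hax y Hy)) in H. rewrite linear_sub by apply HFd. lra. }
  (* Multipliers can be negative, as for a half-space [F >= 1] with [F] affine. Then [Hgap] and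
     [Hside] have opposite signs, so both vanish and the gradients coincide. *)
  assert (Hneg : forall x y, C x -> C y -> a y < 0 ->
            DF y x = DF y y /\ forall h, DF x h = DF y h).
  { intros x y Hx Hy Hay. specialize (Hgap x y Hx Hy). specialize (Hside x y Hx Hy).
    pose proof (bounded_linear_sub _ _ (proj1 (HFd x)) (proj1 (HFd y))) as Hbl.
    set (P := dnorm X (fsub X (DF x) (DF y))) in *.
    pose proof (pw_ge0 P (1 + / alpha)).
    assert (HE : DF y (vsub y x) = 0) by nra.
    split; [rewrite linear_sub in HE by apply HFd; lra|].
    assert (HP : P = 0).
    { destruct (dnorm_ge0 _ Hbl) as [HP|HP]; [|easy]. fold P in HP.
      pose proof (pw_gt0 P (1 + / alpha) HP). nra. }
    intros h. pose proof (dnorm_apply _ h Hbl) as H1. fold P in H1. rewrite HP in H1.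
    unfold fsub in H1. pose proof (Rabs_pos (DF x h - DF y h)).
    assert (H2 : Rabs (DF x h - DF y h) = 0) by lra.
    destruct (Req_dec (DF x h - DF y h) 0) as [|Hn]; [lra|].
    now apply Rabs_no_R0 in Hn. }
  (* Equal gradients with multipliers of opposite sign would squeeze the body into a hyperplane,
     contradicting its interior point and the nonzero gradient. *)
  assert (Hsame : forall x y, C x -> C y -> a y < 0 -> 0 < a x -> False).
  { intros x y Hx Hy Hay Hax0. destruct (Hneg x y Hx Hy Hay) as [H1 H2].
    assert (HL0 : forall h, DF y h = 0).
    { intros h. apply (linear_constant_on_body V _ (DF y y) h Hint (proj1 (proj1 (HFd y)))).
      intros z Hz.
      pose proof (proj2 (Hsup x Hx) z Hz) as Hzx. pose proof (proj2 (Hsup y Hy) z Hz) as Hzy.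
      rewrite !(proj1 (Hax x Hx)), !H2 in Hzx. rewrite !(proj1 (Hax y Hy)) in Hzy. nra. }
    pose proof (Hpos y Hy) as Hp. rewrite (dnorm_eq0 _ (proj1 (HFd y)) HL0) in Hp. lra. }
  assert (H2M : 0 < pw (2 * M) (1 + / alpha)) by (apply pw_gt0; lra).
  (* The factor [M] comes from [a y >= / M], and [2 * M] from [|D x - D y| <= 2 a x P <= 2 M P],
     where [P] is the norm of [DF x - DF y]. *)
  exists (k / (M * pw (2 * M) (1 + / alpha))).
  split; [apply Rdiv_lt_0_compat; nra|]. intros x y Hx Hy. apply Rle_ge.
  destruct (Hax x Hx) as [HDx Hax1]. destruct (Hax y Hy) as [HDy Hay1].
  rewrite HDy. specialize (Hgap x y Hx Hy). specialize (Hside x y Hx Hy).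
  pose proof (bounded_linear_sub _ _ (proj1 (HD x Hx)) (proj1 (HD y Hy))) as HblD.
  pose proof (bounded_linear_sub _ _ (proj1 (HFd x)) (proj1 (HFd y))) as HblF.
  destruct (total_order_T (a y) 0) as [[Hay|Hay]|Hay].
  - destruct (Hneg x y Hx Hy Hay) as [_ Heq].
    (* Multipliers of equal sign over equal gradients agree, so [D x = D y] and the right-hand side
       of (2) is 0. *)
    assert (Haxy : a x = a y).
    { destruct (total_order_T (a x) 0) as [[Hax0|Hax0]|Hax0].
      - rewrite (dnorm_scal (DF x) (DF y) 1), Rabs_R1, Rmult_1_l in Hax1
          by (apply HFd || (intros h; rewrite Heq; lra)).
        rewrite Rabs_left in Hax1, Hay1 by easy. pose proof (Hpos y Hy). nra.
      - rewrite Hax0, Rabs_R0 in Hax1. lra.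
      - exfalso. now apply (Hsame x y). }
    rewrite dnorm_eq0, (pw_nonpos 0); [lra | lra | easy |].
    intros z. unfold fsub. rewrite HDx, HDy, Haxy, Heq. lra.
  - rewrite Hay, Rabs_R0 in Hay1. lra.
  - destruct (total_order_T (a x) 0) as [[Hax0|Hax0]|Hax0].
    { exfalso. now apply (Hsame y x). }
    { rewrite Hax0, Rabs_R0 in Hax1. lra. }
    rewrite Rabs_pos_eq in Hax1, Hay1 by lra.
    pose proof (Hpos x Hx) as Hpx. pose proof (Hpos y Hy) as Hpy.
    set (P := dnorm X (fsub X (DF x) (DF y))) in *.
    assert (HP0 : 0 <= P) by now apply dnorm_ge0.
    assert (HaxM : a x <= M).
    { apply Rmult_le_reg_r with (/ M); [easy|]. rewrite Rinv_r by lra. nra. }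
    assert (HayM : / M <= a y).
    { apply Rmult_le_reg_r with M; [easy|]. rewrite Rinv_l by lra. nra. }
    assert (HDP : dnorm X (fsub X (D x) (D y)) <= 2 * M * P).
    { apply dnorm_le; [easy|]. intros u Hu. unfold fsub. rewrite HDx, HDy.
      pose proof (normalized_difference _ _ _ _ (proj1 (HFd x)) (proj1 (HFd y))
        Hax0 Hax1 Hay1 u Hu) as H. fold P in H. nra. }
    apply (pw_le _ _ (1 + / alpha)) in HDP.
    2: { pose proof (Rinv_0_lt_compat alpha (proj1 Ha)). lra. }
    rewrite pw_mult in HDP by lra.
    pose proof (pw_ge0 P (1 + / alpha)) as Hq.
    apply Rle_trans with (/ M * (k * pw P (1 + / alpha))).
    + apply Rmult_le_compat_l with (r := k / (M * pw (2 * M) (1 + / alpha))) in HDP;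
        [|apply Rlt_le, Rdiv_lt_0_compat; nra].
      apply Rle_trans with (1 := HDP). right. field. lra.
    + apply Rmult_le_compat; nra.
Qed.

End Normals.

Theorem theorem3p4 (alpha : R) (X : Banach) (C : X -> Prop) (D : X -> X -> R) :
  0 < alpha <= 1 ->
  norm_differentiable X ->
  smoothness_power_type X alpha ->
  maps_to_dual_sphere X C D ->
  ((exists V, cond1_body X alpha C D V) <-> cond2 X alpha C D) /\
  (bounded_set X C -> (exists V, cond1_body X alpha C D V) ->
     exists V, cond1_body X alpha C D V /\ bounded_set X V).
Proof.
  intros Ha Hnd Hsm HD.
  assert (H12 : (exists V, cond1_body X alpha C D V) -> cond2 X alpha C D).
  { intros [V HV]. now apply (cond2_of_body alpha C D V). }
  split; [split; [easy|]|].
  - intros H2. destruct (body_of_cond2_all alpha C D Ha Hnd Hsm HD H2) as [V [HV _]].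
    now exists V.
  - intros HCb H1.
    destruct (body_of_cond2_all alpha C D Ha Hnd Hsm HD (H12 H1)) as [V [HV HVb]].
    exists V. split; [easy | now apply HVb].
Qed.
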